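(* Let Assumptions 1 and 2 (stated in the context) hold. Assume furthermore that the optimizer trajectory is bounded as $$\|\hat{x}^\star_{k+1}-\hat{x}^\star_k\|\le \Delta<\infty\qquad\text{for all }k\in\mathbb{N}.$$ Choose $0<\alpha<2\mu/L^2$, $0<\beta<2/L$, and $\chi\in[0,1]$, and let $\{x_k\}_{k\in\mathbb{N}}$ be the sequence generated by $$x_{k+1}=(1-\chi)\,\Phi_{k,g}(x_k)+\chi\,\Psi_g'(\Phi_{k,g}(x_k),y_{k+1}),\qquad k\in\mathbb{N}.$$ Choose the numbers of prediction and correction steps $P$ and $C$ such that $\zeta_{C,\rho_{\rm c}}\,\zeta_{P,\rho_{\rm p}}<1$. Then, with $\varrho_\chi=(1-\chi)\zeta_{P,\rho_{\rm p}}+\chi\,\zeta_{C,\rho_{\rm c}}\zeta_{P,\rho_{\rm p}}$, the asymptotic error is upper bounded as $$\limsup_{k\to\infty}\mathbf{E}[\|x_k-\hat{x}^\star_k\|]\le\frac{1}{1-\varrho_\chi}\Big[(1-\chi)\big[\zeta_{P,\rho_{\rm p}}\Delta+\xi_{P,\rho_{\rm p}}\tau_\mu\big]+\chi\big[\zeta_{C,\rho_{\rm c}}[\zeta_{P,\rho_{\rm p}}\Delta+\xi_{P,\rho_{\rm p}}\tau_\mu]+\sigma_{\rm c}\big]\Big],$$ with $\tau_\mu=\tau/\mu$ and $\sigma_{\rm c}=\beta\sigma/(1-\rho_{\rm c})$ (the right-hand side being read as $+\infty$ if $\varrho_\chi=1$). Finally, in the special linear-Gaussian setting with two-point extrapolation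 predictor described in the context, one can take $\Delta=C_0Ch/\mu$, $\tau_\mu=(C_0Ch^2+3C_0\Sigma)/\mu$ and $\sigma=C_0\Sigma$.
   Context: Problem. Let $f:\mathbb{R}^n\times\mathbb{R}^d\to\mathbb{R}$ be twice differentiable in its first argument and $g:\mathbb{R}^n\to\mathbb{R}\cup\{+\infty\}$ closed, convex and proper. Let $h>0$ be a sampling time, $t_k$ ($k\in\mathbb{N}$) sampling instants with $t_k-t_{k-1}=h$, and let $\mathcal{Y}_k$ be a probability distribution on $\mathbb{R}^d$ for each $k$. At time $t_k$ a random data point $y_k$ drawn from $\mathcal{Y}_k$ is revealed. The filtered optimizers are $$\hat{x}^\star_k=\arg\min_{x\in\mathbb{R}^n}\ \mathbf{E}_{y\in\mathcal{Y}_k}[f(x;y)]+g(x).$$ $J_{k+1}:\mathbb{R}^n\to\mathbb{R}^n$ denotes a (random) approximation, built at time $t_k$ from data available up to time $t_k$, of $x\mapsto\mathbf{E}_{y\in\mathcal{Y}_{k+1}}[\nabla_xf(x;y)]$. $\mathbf{E}[\cdot]$ is expectation over all the data. Assumption 1. $f(x;y)$ is $\mu$-strongly convex and $L$-smooth in $x$, uniformly in $y$; $J_{k+1}$ is $\mu$-strongly monotone and $L$-Lipschitz for all $k$. Assumption 2. There are finite scalars $\tau,\sigma$ such that for all $k\in\mathbb{N}$: (a) $\mathbf{E}[\|J_{k+1}(\hat{x}^\star_{k+1})-\mathbf{E}_{y\in\mathcal{Y}_{k+1}}[\nabla_xf(\hat{x}^\star_{k+1};y)]\|]\le\tau$; (b)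 for all $x\in\mathbb{R}^n$, $\mathbf{E}_{y\in\mathcal{Y}_{k+1}}[\|\nabla_xf(x;y)-\mathbf{E}_{y'\in\mathcal{Y}_{k+1}}[\nabla_xf(x;y')]\|]\le\sigma$. Operators. $\mathrm{prox}_{\alpha g}(x)=\arg\min_v\{g(v)+\frac1{2\alpha}\|v-x\|^2\}$. With integers $P,C\ge0$, $\alpha,\beta>0$, $I$ the identity, and $\circ s$ denoting $s$-fold composition, $$\Phi_{k,g}(x)=[\mathrm{prox}_{\alpha g}(I-\alpha J_{k+1}(\bullet))]^{\circ P}x\quad\text{(prediction)},\qquad \Psi_g'(x,y)=[\mathrm{prox}_{\beta g}(I-\beta\nabla_xf(\bullet;y))]^{\circ C}x\quad\text{(correction)}.$$ The iteration in the claim is the algorithm that alternates prediction and correction with scalar gain $\chi$, started from the deterministic initial prediction $x_{1|0}=0$. Constants. $\rho_{\rm p}=\sqrt{1-2\alpha\mu+\alpha^2L^2}$, $\rho_{\rm c}=\max\{|1-\beta\mu|,|1-\beta L|\}$; $\zeta_{\ell,\rho}=1$ if $\ell=0$ and $\rho^\ell$ otherwise; $\xi_{\ell,\rho}=0$ if $\ell=0$ and $1+\rho^\ell$ otherwise. Special linear-Gaussian setting. $f(x;y)=f'(x)+y^{\mathsf T}Ax$ with $f'$ strongly convex and smooth (so that Assumption 1 holds) and $A$ a matrix with $\|A\|\le C_0$. The data are $y_k=\bar{y}(t_k)+e_k$ with $\bar{y}$ a twice differentiable nominal trajectory with $\|\nabla_t\bar y(t)\|\le C$, $\|\nabla_{tt}\bar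 y(t)\|\le C$ for all $t$, and $e_k\sim\mathcal{N}(0,\Sigma_k)$ with $\sqrt{\mathrm{tr}(\Sigma_k)}\le\Sigma$ for all $k$. The predictor is $J_{k+1}(x)=2\nabla_xf(x;y_k)-\nabla_xf(x;y_{k-1})$. *)

(* Defs.v *)
From HB Require Import structures.
From mathcomp Require Import all_boot all_order all_algebra.
From mathcomp Require Import all_classical all_reals all_analysis.
Set Implicit Arguments.
Unset Strict Implicit.
Unset Printing Implicit Defensive.
Import Order.TTheory GRing.Theory Num.Theory.
Import numFieldNormedType.Exports.

Local Open Scope classical_set_scope.
Local Open Scope ring_scope.

(* Vectors are row vectors. The library norm on matrices is the sup norm (it
   induces the usual topology), hence the separate Euclidean norm. *)
Definition dot (R : realType) (n : nat) (u v : 'rV[R]_n) : R :=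
  \sum_(i < n) u 0 i * v 0 i.

Definition enorm (R : realType) (n : nat) (u : 'rV[R]_n) : R :=
  Num.sqrt (dot u u).

(* ||A||, for A acting on x as A x, i.e. x *m A^T on row vectors *)
Definition opnorm (R : realType) (m n : nat) (A : 'M[R]_(m, n)) : R :=
  sup [set enorm (x *m A^T) | x in [set x : 'rV[R]_n | enorm x <= 1]].

(* R^n with its Borel sigma-algebra *)
Notation borel_rV R n := (g_sigma_algebraType (@open 'rV[R]_n)).

Definition grad (R : realType) (n : nat) (F : 'rV[R]_n -> R) (x : 'rV[R]_n) :
  'rV[R]_n := \row_(i < n) 'D_(delta_mx 0 i) F x.

Definition twice_differentiable (R : realType) (n : nat) (F : 'rV[R]_n -> R) :=
  (forall x, differentiable F x) /\ (forall x, differentiable (grad F) x).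

Definition strongly_convex (R : realType) (n : nat) (mu : R)
    (F : 'rV[R]_n -> R) :=
  forall (x z : 'rV[R]_n) (t : R), 0 <= t <= 1 ->
    F (t *: x + (1 - t) *: z) <=
      t * F x + (1 - t) * F z - mu / 2 * (t * (1 - t)) * enorm (x - z) ^+ 2.

Definition elipschitz (R : realType) (n : nat) (L : R)
    (T : 'rV[R]_n -> 'rV[R]_n) :=
  forall x z, enorm (T x - T z) <= L * enorm (x - z).

Definition smooth (R : realType) (n : nat) (L : R) (F : 'rV[R]_n -> R) :=
  elipschitz L (grad F).

Definition strongly_monotone (R : realType) (n : nat) (mu : R)
    (T : 'rV[R]_n -> 'rV[R]_n) :=
  forall x z, mu * enorm (x - z) ^+ 2 <= dot (T x - T z) (x - z).

Definition closed_convex_proper (R : realType) (n : nat)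
    (g : 'rV[R]_n -> \bar R) :=
  [/\ closed [set p : 'rV[R]_n * R | (g p.1 <= p.2%:E)%E],
      forall (x z : 'rV[R]_n) (t : R), 0 <= t <= 1 ->
        (g (t *: x + (1 - t) *: z)%R <= t%:E * g x + (1 - t)%:E * g z)%E,
      forall x, g x <> -oo%E &
      exists x, g x <> +oo%E].

(* Total by choice: an arbitrary minimizer, and a default point if there is
   none. Under the standing assumptions the objectives to which it is applied
   are proper, closed and strongly convex, so that their minimizer exists and
   is unique. *)
Definition argmin (R : realType) (n : nat) (F : 'rV[R]_n -> \bar R) :
  'rV[R]_n := get [set x | forall v, (F x <= F v)%E].

Definition prox (R : realType) (n : nat) (a : R) (g : 'rV[R]_n -> \bar R)
    (x : 'rV[R]_n) : 'rV[R]_n :=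
  argmin (fun v => g v + ((2 * a)^-1 * enorm (v - x) ^+ 2)%:E)%E.

Definition optimizer (R : realType) (n d : nat)
    (f : 'rV[R]_n -> 'rV[R]_d -> R) (g : 'rV[R]_n -> \bar R)
    (Y : nat -> probability (borel_rV R d) R) (k : nat) : 'rV[R]_n :=
  argmin (fun x => 'E_(Y k)[f x] + g x)%E.

Definition mean_grad (R : realType) (n d : nat)
    (f : 'rV[R]_n -> 'rV[R]_d -> R) (Yk : probability (borel_rV R d) R)
    (x : 'rV[R]_n) : 'rV[R]_n :=
  \row_(i < n) fine ('E_Yk[fun y => (grad (f ^~ y) x 0 i)%R])%E.

(* In everything that follows the sampling index k ranges over {1, 2, ...}: the
   first iterate is x_1. The datum y_0 may only enter as past data of the
   predictors. J k w is the operator J_k for the outcome w. *)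

(* the sigma-algebra generated by y_0, ..., y_k *)
Definition data_sigma (R : realType) (d : nat) (dsp : measure_display)
    (Omega : measurableType dsp) (y : nat -> Omega -> borel_rV R d) (k : nat) :
  set (set Omega) :=
  <<s \bigcup_(j in [set j | (j <= k)%N])
        preimage_set_system setT (y j) measurable >>.

(* J_{k+1} is built from the data available up to time t_k *)
Definition predictable (R : realType) (n d : nat) (dsp : measure_display)
    (Omega : measurableType dsp) (y : nat -> Omega -> borel_rV R d)
    (J : nat -> Omega -> 'rV[R]_n -> 'rV[R]_n) :=
  forall k, (0 < k)%N -> forall (x : 'rV[R]_n) (B : set (borel_rV R n)),
    measurable B -> data_sigma y k [set w | B (J k.+1 w x)].

Definition assumption1 (R : realType) (n d : nat) (dsp : measure_display)
    (Omega : measurableType dsp) (mu L : R) (f : 'rV[R]_n -> 'rV[R]_d -> R)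
    (J : nat -> Omega -> 'rV[R]_n -> 'rV[R]_n) :=
  (forall y, strongly_convex mu (f ^~ y) /\ smooth L (f ^~ y)) /\
  (forall k, (0 < k)%N -> forall w,
     strongly_monotone mu (J k.+1 w) /\ elipschitz L (J k.+1 w)).

Definition assumption2 (R : realType) (n d : nat) (dsp : measure_display)
    (Omega : measurableType dsp) (Pr : probability Omega R)
    (f : 'rV[R]_n -> 'rV[R]_d -> R) (Y : nat -> probability (borel_rV R d) R)
    (J : nat -> Omega -> 'rV[R]_n -> 'rV[R]_n)
    (xs : nat -> 'rV[R]_n) (tau sigma : R) :=
  forall k, (0 < k)%N ->
    ('E_Pr[fun w => (enorm (J k.+1 w (xs k.+1) -
                           mean_grad f (Y k.+1) (xs k.+1)))%R] <= tau%:E)%E /\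
    (forall x, ('E_(Y k.+1)[fun y => (enorm (grad (f ^~ y) x -
                           mean_grad f (Y k.+1) x))%R] <= sigma%:E)%E).

Definition bounded_drift (R : realType) (n : nat) (xs : nat -> 'rV[R]_n)
    (Delta : R) :=
  forall k, (0 < k)%N -> enorm (xs k.+1 - xs k) <= Delta.

Definition prediction (R : realType) (n : nat) (alpha : R)
    (g : 'rV[R]_n -> \bar R) (T : 'rV[R]_n -> 'rV[R]_n) (p : nat)
    (x : 'rV[R]_n) : 'rV[R]_n :=
  iter p (fun z => prox alpha g (z - alpha *: T z)) x.

Definition correction (R : realType) (n d : nat) (beta : R)
    (g : 'rV[R]_n -> \bar R) (f : 'rV[R]_n -> 'rV[R]_d -> R) (c : nat)
    (x : 'rV[R]_n) (y : 'rV[R]_d) : 'rV[R]_n :=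
  iter c (fun z => prox beta g (z - beta *: grad (f ^~ y) z)) x.

Definition filter_step (R : realType) (n d : nat) (beta chi : R)
    (g : 'rV[R]_n -> \bar R) (f : 'rV[R]_n -> 'rV[R]_d -> R) (c : nat)
    (xpred : 'rV[R]_n) (y : 'rV[R]_d) : 'rV[R]_n :=
  (1 - chi) *: xpred + chi *: correction beta g f c xpred y.

(* x_{1|0} = 0 and x_{k+1|k} = prediction from x_k; x 0 is irrelevant *)
Definition generated (R : realType) (n d : nat) (Omega : Type)
    (alpha beta chi : R) (g : 'rV[R]_n -> \bar R)
    (f : 'rV[R]_n -> 'rV[R]_d -> R) (J : nat -> Omega -> 'rV[R]_n -> 'rV[R]_n)
    (p c : nat) (y : nat -> Omega -> 'rV[R]_d) (x : nat -> Omega -> 'rV[R]_n) :=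
  forall w, x 1 w = filter_step beta chi g f c 0 (y 1 w) /\
    forall k, (0 < k)%N ->
      x k.+1 w = filter_step beta chi g f c
                   (prediction alpha g (J k.+1 w) p (x k w)) (y k.+1 w).

Definition rho_p (R : realType) (mu L alpha : R) : R :=
  Num.sqrt (1 - 2 * alpha * mu + alpha ^+ 2 * L ^+ 2).

Definition rho_c (R : realType) (mu L beta : R) : R :=
  Num.max `|1 - beta * mu| `|1 - beta * L|.

Definition zeta (R : realType) (l : nat) (rho : R) : R :=
  if l == 0%N then 1 else rho ^+ l.

Definition xi (R : realType) (l : nat) (rho : R) : R :=
  if l == 0%N then 0 else 1 + rho ^+ l.

Definition varrho (R : realType) (chi zp zc : R) : R :=
  (1 - chi) * zp + chi * (zc * zp).

Definition error_bound (R : realType) (mu L alpha beta chi : R) (p c : nat)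
    (Delta tau_mu sigma : R) : \bar R :=
  let zp := zeta p (rho_p mu L alpha) in
  let zc := zeta c (rho_c mu L beta) in
  let xip := xi p (rho_p mu L alpha) in
  let sigma_c := beta * sigma / (1 - rho_c mu L beta) in
  let r := varrho chi zp zc in
  if r == 1 then +oo%E else
  ((1 - r)^-1 * ((1 - chi) * (zp * Delta + xip * tau_mu)
                 + chi * (zc * (zp * Delta + xip * tau_mu) + sigma_c)))%:E.

(* X ~ N(m, S), S possibly singular: every <u, X> is N(<u, m>, u S u^T) on the
   line, read as a point mass when the variance is 0 (for which the library's
   normal_prob, parameterized by the standard deviation, has a junk value). *)
Definition gaussian (R : realType) (d : nat) (dsp : measure_display)
    (Omega : measurableType dsp) (Pr : probability Omega R)
    (X : Omega -> 'rV[R]_d) (m : 'rV[R]_d) (S : 'M[R]_d) :=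
  [/\ S^T = S,
      forall u : 'rV[R]_d, 0 <= (u *m S *m u^T) 0 0 &
      forall (u : 'rV[R]_d) (B : set R), measurable B ->
        let v := (u *m S *m u^T) 0 0 in
        Pr [set w | B (dot u (X w))] =
          if v == 0 then \d_(dot u m) B
          else normal_prob (dot u m) (Num.sqrt v) B].

(* y^T A x, with x and y stored as rows *)
Definition linear_cost (R : realType) (n d : nat) (f' : 'rV[R]_n -> R)
    (A : 'M[R]_(d, n)) (x : 'rV[R]_n) (y : 'rV[R]_d) : R :=
  f' x + (y *m A *m x^T) 0 0.

(* J_k for k >= 2, i.e. J_{k+1} for k >= 1 *)
Definition two_point (R : realType) (n d : nat) (Omega : Type)
    (f : 'rV[R]_n -> 'rV[R]_d -> R) (y : nat -> Omega -> 'rV[R]_d)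
    (k : nat) (w : Omega) (x : 'rV[R]_n) : 'rV[R]_n :=
  2 *: grad (f ^~ (y k.-1 w)) x - grad (f ^~ (y k.-2 w)) x.

(* Main.v *)
Require Import Defs.
From HB Require Import structures.
From mathcomp Require Import all_boot all_order all_algebra.
From mathcomp Require Import all_classical all_reals all_analysis.
From mathcomp Require Import measurable_realfun ring lra.
Import Order.TTheory GRing.Theory Num.Theory.
Import numFieldNormedType.Exports.
Local Open Scope classical_set_scope.
Set Implicit Arguments.
Unset Strict Implicit.
Unset Printing Implicit Defensive.
Local Open Scope ring_scope.

(** The optimizer [xs k] at time [k] is characterized by a variational inequality,
    [g (xs k) <= g v + <q, v - xs k>] for all [v], where [q] is the mean gradient at
    [xs k] ([optimizer_stationary]). Since [argmin] is a choice, existence of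
    minimizers comes first: a closed convex [g] decreases at most linearly
    ([proper_lower_bound]), so that [g] plus a strongly convex function has compact
    sublevel sets and attains its minimum ([composite_minimizer]). Such inequalities
    are monotone in the point, so proximal maps are nonexpansive, and a point
    satisfies the inequality for [q] exactly when it is fixed by the
    forward-backward step with gradient [q] ([prox_fixed_point]).

    A correction step is a contraction of ratio [rho_c] by co-coercivity of the
    gradient ([quad_bounds_cocoercive], [forward_smooth]); using a sampled gradient
    in place of the mean one displaces [xs k] by [beta] times the gradient noise at
    [xs k], which sums to a geometric series ([correction_error]). A prediction step
    is a contraction of ratio [rho_p]; its fixed point is stationary for the
    predictor, hence within [1 / mu] times the predictor error at [xs k] from
    [xs k] by strong monotonicity ([stationary_perturbation]), which yields the
    factor [1 + rho_p ^+ P] ([prediction_error]).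

    Together with the drift of the optimizer, the error is at each step multiplied
    by [varrho] and increased by a combination of the drift, the predictor error
    and the gradient noise. The last two only involve the deterministic optimizer,
    so their expectations are bounded by [tau] and [sigma], and the affine recursion
    on expectations gives the limit superior ([limn_esup_affine],
    [tracking_error_limsup]). If [varrho] is 1 the bound is infinite.

    In the linear-Gaussian setting the gradients for data [y] and [z] differ by
    [(y - z) A]. The mean datum is the nominal one, so the drift is governed by the
    first difference of the nominal trajectory, the predictor error by its second
    difference and by [2 e_k - e_(k-1)], and the gradient noise by [e_k]. The
    differences are bounded by the mean value theorem ([mean_value_enorm],
    [second_difference_enorm]) and the expected norm of a centered Gaussian vector
    by the square root of the trace of its covariance ([gaussian_enorm_le]). *)

(** * Euclidean geometry of row vectors *)

Section Euclid.
Context {R : realType} {n : nat}.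
Implicit Types (u v w x z : 'rV[R]_n) (a : R).

Lemma dotC u v : dot u v = dot v u.
Proof. by apply: eq_bigr => i _; rewrite mulrC. Qed.

Lemma dotDl u v w : dot (u + v) w = dot u w + dot v w.
Proof. by rewrite -big_split; apply: eq_bigr => i _; rewrite mxE mulrDl. Qed.

Lemma dotZl a u v : dot (a *: u) v = a * dot u v.
Proof. by rewrite mulr_sumr; apply: eq_bigr => i _; rewrite mxE mulrA. Qed.

Lemma dotNl u v : dot (- u) v = - dot u v.
Proof. by rewrite -scaleN1r dotZl mulN1r. Qed.

Lemma dotBl u v w : dot (u - v) w = dot u w - dot v w.
Proof. by rewrite dotDl dotNl. Qed.

Lemma dotDr u v w : dot w (u + v) = dot w u + dot w v.
Proof. by rewrite !(dotC w) dotDl. Qed.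

Lemma dotZr a u v : dot v (a *: u) = a * dot v u.
Proof. by rewrite !(dotC v) dotZl. Qed.

Lemma dotNr u v : dot v (- u) = - dot v u.
Proof. by rewrite !(dotC v) dotNl. Qed.

Lemma dotBr u v w : dot w (u - v) = dot w u - dot w v.
Proof. by rewrite dotDr dotNr. Qed.

Lemma dot0l u : dot 0 u = 0.
Proof. by rewrite -(scale0r 0) dotZl mul0r. Qed.

Lemma dot0r u : dot u 0 = 0.
Proof. by rewrite dotC dot0l. Qed.

Definition dotE := (dotDl, dotDr, dotNl, dotNr, dotZl, dotZr).

Lemma dot_ge0 u : 0 <= dot u u.
Proof. by apply: sumr_ge0 => i _; rewrite -expr2 sqr_ge0. Qed.

Lemma enorm_ge0 u : 0 <= enorm u.
Proof. exact: sqrtr_ge0. Qed.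

Lemma enorm_sqr u : enorm u ^+ 2 = dot u u.
Proof. by rewrite sqr_sqrtr// dot_ge0. Qed.

Lemma coord_le_enorm u i : `|u 0 i| <= enorm u.
Proof.
rewrite -sqrtr_sqr ler_wsqrtr// /dot (bigD1 i)//= -expr2 lerDl.
by apply: sumr_ge0 => j _; rewrite -expr2 sqr_ge0.
Qed.

Lemma enorm_eq0 u : enorm u = 0 -> u = 0.
Proof.
move=> u0; apply/rowP => i; rewrite mxE; apply/eqP.
by rewrite -normr_le0 -u0 coord_le_enorm.
Qed.

Lemma enorm0 : enorm (0 : 'rV[R]_n) = 0.
Proof. by rewrite /enorm dot0l sqrtr0. Qed.

Lemma enormZ a u : enorm (a *: u) = `|a| * enorm u.
Proof.
by rewrite /enorm !dotE mulrA -expr2 sqrtrM ?sqr_ge0// sqrtr_sqr.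
Qed.

Lemma enormN u : enorm (- u) = enorm u.
Proof. by rewrite /enorm !dotE opprK. Qed.

Lemma enormC u v : enorm (u - v) = enorm (v - u).
Proof. by rewrite -enormN opprB. Qed.

Lemma enorm_dist_eq0 u v : enorm (u - v) = 0 -> u = v.
Proof. by move=> /enorm_eq0 /eqP; rewrite subr_eq0 => /eqP. Qed.

(** Cauchy-Schwarz, from the nonnegativity of
    [dot w w] for [w = |v| u - |u| v]. *)
Lemma dot_le_enorm u v : dot u v <= enorm u * enorm v.
Proof.
have [/enorm_eq0 ->|u0] := eqVneq (enorm u) 0; first by rewrite dot0l enorm0 mul0r.
have [/enorm_eq0 ->|v0] := eqVneq (enorm v) 0; first by rewrite dot0r enorm0 mulr0.
have pu : 0 < enorm u by rewrite lt_def u0 enorm_ge0.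
have pv : 0 < enorm v by rewrite lt_def v0 enorm_ge0.
have := dot_ge0 (enorm v *: u - enorm u *: v).
rewrite !dotE -!enorm_sqr (dotC v u) => h.
have : 0 <= (2 * enorm u * enorm v) * (enorm u * enorm v - dot u v) by nra.
by rewrite pmulr_rge0 ?subr_ge0//; nra.
Qed.

Lemma abs_dot_le_enorm u v : `|dot u v| <= enorm u * enorm v.
Proof.
rewrite ler_norml dot_le_enorm andbT lerNl -dotNl -(enormN u).
exact: dot_le_enorm.
Qed.

Lemma enormD u v : enorm (u + v) <= enorm u + enorm v.
Proof.
rewrite -(ler_pXn2r (n := 2))// ?nnegrE ?addr_ge0 ?enorm_ge0//.
rewrite enorm_sqr !dotE -!enorm_sqr (dotC v u).
have := dot_le_enorm u v; nra.
Qed.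

Lemma enorm_triangle v u w : enorm (u - w) <= enorm (u - v) + enorm (v - w).
Proof. by apply: le_trans (enormD _ _); rewrite addrA subrK. Qed.

Lemma le_enorm_sqr u a : 0 <= a -> dot u u <= a ^+ 2 -> enorm u <= a.
Proof.
by move=> a0; rewrite -enorm_sqr ler_pXn2r// nnegrE enorm_ge0.
Qed.

Lemma enorm_le_sum u : enorm u <= \sum_i `|u 0 i|.
Proof.
apply: le_enorm_sqr; first exact: sumr_ge0.
rewrite expr2 mulr_suml; apply: ler_sum => i _.
rewrite (le_trans (ler_norm _))// normrM ler_wpM2l//.
by rewrite (bigD1 i)//= lerDl sumr_ge0.
Qed.

Lemma dot_continuous (T : topologicalType) (f h : T -> 'rV[R]_n) :
  continuous f -> continuous h -> continuous (fun t => dot (f t) (h t)).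
Proof.
move=> cf ch t; rewrite /dot.
move: t; apply: continuous_big => [|i _ t]; first exact: add_continuous.
apply: cvgM.
  exact: (continuous_comp (cf t) (@coord_continuous _ _ _ 0 i _)).
exact: (continuous_comp (ch t) (@coord_continuous _ _ _ 0 i _)).
Qed.

Lemma enorm_continuous (T : topologicalType) (f : T -> 'rV[R]_n) :
  continuous f -> continuous (fun t => enorm (f t)).
Proof.
move=> cf t; apply: (@continuous_comp _ _ _ (fun t => dot (f t) (f t))).
  exact: dot_continuous.
exact: sqrt_continuous.
Qed.

Lemma enorm_dist_continuous x : continuous (fun z => enorm (z - x)).
Proof.
apply: enorm_continuous => z.
by apply: continuousB; [exact: cvg_id|exact: cst_continuous].
Qed.

Lemma rV_continuous (T : topologicalType) (f : T -> 'rV[R]_n) :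
  (forall i, continuous (fun t => f t 0 i)) -> continuous f.
Proof.
move=> cf t; apply/(@cvgrPdist_lt _ ('rV[R]_n)) => e e0.
have : \forall s \near t, forall i, `|f t 0 i - f s 0 i| < e.
  by apply: filter_forall => i; move/cvgrPdist_lt: (cf i t) => /(_ e e0).
apply: filterS => s hs; rewrite [ltLHS]/Num.norm/= mx_normrE.
by apply/bigmax_ltP; split => // -[i j] _; rewrite !mxE ord1.
Qed.

Lemma continuous_cmul (T : topologicalType) (h : T -> R) a :
  continuous h -> continuous (fun t => a * h t).
Proof.
move=> ch t; apply: (@continuous_comp _ _ _ h _ t (ch t)).
exact: mulrl_continuous.
Qed.

Lemma continuous_quadratic (T : topologicalType) (h : T -> R) a b :
  continuous h -> continuous (fun t => a * h t + b * h t ^+ 2).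
Proof.
move=> ch t; apply: cvgD; first exact: continuous_cmul.
apply: (@continuous_cmul _ (fun t => h t ^+ 2)) => {}t.
by apply: cvgM; exact: ch.
Qed.

(** Pulls a closed epigraph back to a closed sublevel set. *)
Lemma continuous_epi (T : topologicalType) (h : T -> R) a :
  continuous h -> continuous (fun t => (t, a - h t)).
Proof.
move=> ch t.
apply: (@cvg_pair _ _ _ (nbhs t) (nbhs t) (nbhs (a - h t))); first exact: cvg_id.
by apply: cvgB; [exact: cvg_cst|exact: ch].
Qed.

Lemma continuous_dominated (T : topologicalType) (f h : T -> R) (t : T) :
  continuous h -> h t = 0 -> (forall s, `|f s - f t| <= h s) ->
  f s @[s --> t] --> f t.
Proof.
move=> ch h0 fh; apply/cvgrPdist_lt => e e0.
move/cvgrPdist_lt: (ch t) => /(_ e e0); apply: filterS => s.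
rewrite h0 distrC subr0 => /(le_lt_trans (ler_norm _)); apply: le_lt_trans.
by rewrite distrC.
Qed.

(** The topology of row vectors is that of the sup norm: continuity is checked
    on coordinates, each of which is bounded by the Euclidean norm. *)
Lemma elipschitz_continuous (F : 'rV[R]_n -> 'rV[R]_n) L :
  elipschitz L F -> continuous F.
Proof.
move=> lF; apply: rV_continuous => i x.
apply: (continuous_dominated (h := fun z => L * enorm (z - x))) => [z||z].
    exact: (continuous_cmul (@enorm_dist_continuous x)).
  by rewrite subrr enorm0 mulr0.
apply: le_trans (lF z x).
by have := coord_le_enorm (F z - F x) i; rewrite !mxE.
Qed.

End Euclid.

(** * Convex minimization and proximal maps *)

(** For a function [F] with gradient [G], this is strong convexity together with
    smoothness. In this form the property passes to averages over a parameter by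
    integrating both inequalities, and it mentions no derivative. *)
Definition quad_bounds (R : realType) (n : nat) (mu L : R)
    (F : 'rV[R]_n -> R) (G : 'rV[R]_n -> 'rV[R]_n) :=
  forall x z,
    F x + dot (G x) (z - x) + mu / 2 * enorm (z - x) ^+ 2 <= F z /\
    F z <= F x + dot (G x) (z - x) + L / 2 * enorm (z - x) ^+ 2.

(** [- q] is a subgradient of [g] at [x]: the first order optimality condition of
    [g + F] at [x] when [q] is the gradient of [F] there. *)
Definition stationary (R : realType) (n : nat) (g : 'rV[R]_n -> \bar R)
    (q x : 'rV[R]_n) :=
  forall v, (g x <= g v + (dot q (v - x))%:E)%E.

Lemma le0_small (R : realType) (s K : R) :
  (forall t, 0 < t <= 1 -> s <= t * K) -> s <= 0.
Proof.
move=> h; rewrite leNgt; apply/negP => s0.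
have pK : 0 < s + `|K| by rewrite ltr_wpDr.
have := h (s / (s + `|K|)).
rewrite divr_gt0//= ler_pdivrMr// mul1r lerDl normr_ge0 => /(_ isT).
rewrite mulrAC ler_pdivlMr// leNgt => /negP; apply.
by rewrite ltr_pM2l// (le_lt_trans (ler_norm _))// ltrDr.
Qed.

Section Minimization.
Context {R : realType} {n : nat}.
Implicit Types (g h : 'rV[R]_n -> \bar R) (F : 'rV[R]_n -> R)
  (G : 'rV[R]_n -> 'rV[R]_n) (q u v w x z : 'rV[R]_n).

(** The nonempty sublevel sets generate a proper filter that contains a compact
    set; it has a cluster point, which lies in all these closed sets. *)
Lemma coercive_minimizer h :
  (forall r : R, closed [set x | (h x <= r%:E)%E]) ->
  (forall r : R, exists M, forall x, (h x <= r%:E)%E -> enorm x <= M) ->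
  exists x, forall v, (h x <= h v)%E.
Proof.
move=> hcl hbd.
pose S := [set r : R | exists x, (h x <= r%:E)%E].
have [[r0 [x0 hx0]]|S0] := pselect (S !=set0); last first.
  exists 0 => v; case E : (h v) => [r| |]; last 2 first.
  - by rewrite leey.
  - by exfalso; apply: S0; exists 0; exists v; rewrite E leNye.
  - by exfalso; apply: S0; exists r; exists v; rewrite E.
pose lev (r : R) := [set x | (h x <= r%:E)%E].
have FF : ProperFilter (filter_from S lev).
  apply: filter_from_proper; last by move=> r [x hx]; exists x.
  apply: filter_from_filter; first by exists r0, x0.
  move=> r s [x hx] [z hz]; exists (Num.min r s).
    by case: (leP r s) => _; [exists x|exists z].
  move=> u; rewrite /lev/= => hu; split; apply: (le_trans hu);
    by rewrite lee_fin ge_min lexx ?orbT.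
have [M hM] := hbd r0.
have Kc : compact (lev r0).
  apply: (@subclosed_compact _ _ [set v : 'rV[R]_n | forall i, `[- M, M]%classic (v ord0 i)]).
  - exact: hcl.
  - by apply: (@rV_compact _ _ (fun=> `[- M, M]%classic)) => _; exact: segment_compact.
  - move=> v /hM vM i /=; rewrite in_itv/= -ler_norml.
    exact: le_trans (coord_le_enorm _ _) vM.
have [|p [_ pcl]] := Kc (filter_from S lev) FF.
  by exists r0 => //; exists x0.
have pr r : S r -> (h p <= r%:E)%E.
  move=> Sr; apply: (hcl r) => B Bp.
  by apply: pcl Bp; exists r.
exists p => v; case E : (h v) => [r| |].
- by apply: pr; exists v; rewrite E.
- by rewrite leey.
- suff -> : h p = -oo%E by [].
  by apply: eq_ninfty => r; apply: pr; exists v; rewrite E leNye.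
Qed.

Lemma quad_bounds_continuous mu L F G : quad_bounds mu L F G -> continuous F.
Proof.
move=> FG x.
pose K := `|mu| / 2 + `|L| / 2.
apply: (@continuous_dominated _ _ _
  (fun z => enorm (G x) * enorm (z - x) + K * enorm (z - x) ^+ 2)).
- exact: (continuous_quadratic (@enorm_dist_continuous _ _ x)).
- by rewrite subrr enorm0; ring.
- move=> z; have [lo up] := FG x z.
  have := abs_dot_le_enorm (G x) (z - x); rewrite ler_norml => /andP[d1 d2].
  have m1 := ler_norm (- mu); have l1 := ler_norm L; rewrite normrN in m1.
  have n1 := normr_ge0 mu; have n2 := normr_ge0 L.
  have e2 := sqr_ge0 (enorm (z - x)).
  by rewrite ler_norml /K; apply/andP; split; nra.
Qed.

Section Proper.
Variables (g : 'rV[R]_n -> \bar R) (gP : closed_convex_proper g).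

Lemma stationary_fin_num q x : stationary g q x -> g x \is a fin_num.
Proof.
case: gP => _ _ gNy [v gv] /(_ v); move: (gNy x) (gNy v) gv.
by case: (g x) => //; case: (g v).
Qed.

Lemma epigraph_sublevel_closed F (r : R) : continuous F ->
  closed [set v | (g v + (F v)%:E <= r%:E)%E].
Proof.
move=> cF; case: gP => gcl _ _ _.
rewrite (_ : [set v | _] = (fun v => (v, r - F v)) @^-1` [set p | (g p.1 <= p.2%:E)%E]).
  by apply: (continuous_closedP _).1 gcl; exact: continuous_epi.
apply/seteqP; split => v /=; case: (g v) => [a| |]//=; rewrite ?lee_fin ?leNye//.
  by rewrite lerBrDr.
by rewrite lerBrDr.
Qed.

(** On a ball around a point of its domain, [g] is bounded below because it is
    lower semicontinuous; convexity along rays extends the bound to the whole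
    space at a linear rate. *)
Lemma proper_lower_bound : exists x0 c,
  0 <= c /\ forall v, ((- (c * (1 + enorm (v - x0))))%:E <= g v)%E.
Proof.
case: (gP) => gcl gcv gNy [x0 gx0].
pose h x := if enorm (x - x0) <= 1 then g x else +oo%E.
have [p hp] : exists p, forall v, (h p <= h v)%E.
  apply: coercive_minimizer => r; last first.
    exists (1 + enorm x0) => x; rewrite /h; case: ifPn => // h1 _.
    by rewrite -[x](subrK x0) (le_trans (enormD _ _))// lerD2r.
  rewrite (_ : [set x | _] = [set x | enorm (x - x0) <= 1] `&`
    [set v | (g v + 0%:E <= r%:E)%E]).
    apply: closedI; last by apply: epigraph_sublevel_closed; exact: cst_continuous.
    have := (continuous_closedP _).1 (@enorm_dist_continuous _ _ x0) _ (@closed_le R 1).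
    by [].
  apply/seteqP; split => x; rewrite /h /= adde0; first by case: ifPn.
  by case=> ->.
have hx0 : h x0 = g x0 by rewrite /h subrr enorm0 ler01.
have : g x0 \is a fin_num by rewrite fin_numE; apply/andP; split; apply/eqP.
case E0 : (g x0) => [a| |]// _.
have [m hm] : exists m, forall v, enorm (v - x0) <= 1 -> (m%:E <= g v)%E.
  have := hp x0; rewrite hx0 E0.
  case Ep : (h p) => [m| |]// _.
    by exists m => v v1; have := hp v; rewrite Ep /h v1.
  by move: Ep; rewrite /h; case: ifP => // _ /gNy.
exists x0, (`|m| + `|a|); split; first by rewrite addr_ge0.
move=> v; set r := enorm (v - x0); have r0 : 0 <= r := enorm_ge0 _.
have nm := ler_norm (- m); rewrite normrN in nm.
have na := ler_norm a; have n0 := normr_ge0 m; have n1 := normr_ge0 a.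
have [r1|r1] := leP r 1.
  apply: le_trans (hm v r1); rewrite lee_fin; nra.
have rp : 0 < r by apply: lt_trans r1.
have rv1 : 0 <= r^-1 <= 1 by rewrite invr_ge0 r0/= invf_le1// ltW.
have := gcv v x0 r^-1 rv1.
have -> : r^-1 *: v + (1 - r^-1) *: x0 = x0 + r^-1 *: (v - x0).
  by apply/rowP => i; rewrite !mxE; ring.
have := hm (x0 + r^-1 *: (v - x0)).
rewrite addrAC subrr add0r enormZ -/r.
have -> : `|r^-1| * r = 1 by rewrite gtr0_norm ?invr_gt0// mulVf// gt_eqF.
move=> /(_ (lexx _)) /le_trans /[apply]; rewrite E0.
case: (g v) => [b| |].
- rewrite -!EFinM -EFinD !lee_fin => hb.
  have : r * m <= b + (r - 1) * a.
    have -> : b + (r - 1) * a = r * (r^-1 * b + (1 - r^-1) * a).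
      by field; rewrite gt_eqF.
    by rewrite ler_pM2l.
  nra.
- by rewrite leey.
- by rewrite mulrNy gtr0_sg ?invr_gt0// mul1e.
Qed.

(** The quadratic growth of [F] dominates the linear rate at which [g] may
    decrease, so the sublevel sets of the sum are bounded. *)
Lemma composite_minimizer mu L F G : 0 < mu -> quad_bounds mu L F G ->
  exists x, forall v, (g x + (F x)%:E <= g v + (F v)%:E)%E.
Proof.
move=> mu0 FG; have [x0 [c [c0 gc]]] := proper_lower_bound.
apply: coercive_minimizer => r.
  exact/epigraph_sublevel_closed/(quad_bounds_continuous FG).
pose K := `|r - F x0 + c| + c + enorm (G x0).
have K0 : 0 <= K by rewrite !addr_ge0 ?enorm_ge0.
have K1 : 0 <= 2 * K / mu by rewrite divr_ge0 ?(ltW mu0)// mulr_ge0.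
exists (1 + 2 * K / mu + enorm x0) => v hv.
rewrite -[v](subrK x0) (le_trans (enormD _ _))// lerD2r.
set t := enorm (v - x0); have t0 : 0 <= t := enorm_ge0 _.
have : - (c * (1 + t)) + F v <= r.
  rewrite -lee_fin (le_trans _ hv)// EFinD leeD2r//; exact: gc.
have [lo _] := FG x0 v; rewrite -/t in lo.
have := abs_dot_le_enorm (G x0) (v - x0); rewrite ler_norml -/t => /andP[d1 _].
move=> h.
have [t1|t1] := leP t 1; first by rewrite ler_wpDr.
rewrite ler_wpDl// ler_pdivlMr//.
have a0 := normr_ge0 (r - F x0 + c).
have a1 := ler_norm (r - F x0 + c).
have : mu / 2 * t ^+ 2 <= `|r - F x0 + c| * 1 + (c + enorm (G x0)) * t by lra.
move=> h2.
have : t * (t * mu) <= t * (2 * K) by rewrite /K; nra.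
by rewrite ler_pM2l// (lt_trans _ t1).
Qed.

(** First order condition: compare the minimum with its values along the segment
    towards [v], at which [F] differs from its linearization at second order
    only. *)
Lemma minimizer_stationary mu L F G x : quad_bounds mu L F G ->
  (forall v, (g x + (F x)%:E <= g v + (F v)%:E)%E) -> stationary g (G x) x.
Proof.
move=> FG xmin v; case: (gP) => _ gcv gNy [x1 gx1].
have gxf : g x \is a fin_num.
  move: (xmin x1) (gNy x) (gNy x1) gx1.
  by case: (g x) => //; case: (g x1).
move: (gNy v); case Ev : (g v) => [b| |]// _; last by rewrite leey.
case Ex : (g x) gxf => [a| |]// _.
rewrite -EFinD lee_fin -lerBlDl -subr_le0.
apply: (@le0_small _ _ (L / 2 * enorm (v - x) ^+ 2)) => t /andP[t0 t1].
have := gcv v x t; rewrite (ltW t0) t1 => /(_ isT).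
have := xmin (t *: v + (1 - t) *: x).
have [_] := FG x (t *: v + (1 - t) *: x).
have -> : t *: v + (1 - t) *: x - x = t *: (v - x).
  by apply/rowP => i; rewrite !mxE; ring.
rewrite dotZr enormZ exprMn real_normK ?num_real// Ev Ex.
case: (g _) => [b'| |]; rewrite -?EFinM -?EFinD ?lee_fin//.
move=> h1 h2 h3; rewrite -(ler_pM2l t0).
lra.
Qed.

(** The objective [H] is separate from [g] and [F] because it may be given in
    another form, such as an expectation. *)
Lemma argmin_stationary mu L F G (H : 'rV[R]_n -> \bar R) :
  0 < mu -> quad_bounds mu L F G ->
  (forall v, H v = (g v + (F v)%:E)%E) -> stationary g (G (argmin H)) (argmin H).
Proof.
move=> mu0 FG HE; apply: (minimizer_stationary FG) => v.
have [x xmin] := composite_minimizer mu0 FG.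
have : [set x | forall v, (H x <= H v)%E] (argmin H).
  by apply: getPex; exists x => z; rewrite !HE.
by move/(_ v); rewrite !HE.
Qed.

(** Monotonicity of the subdifferential of [g]: each of the two inequalities is
    tested at the other point, and the values of [g] cancel in the sum. *)
Lemma stationary_monotone p q x z : stationary g p x -> stationary g q z ->
  dot (p - q) (x - z) <= 0.
Proof.
move=> px qz; have := stationary_fin_num px; have := stationary_fin_num qz.
move: (px z) (qz x); case: (g x) => [a| |]//; case: (g z) => [b| |]//.
rewrite -!EFinD !lee_fin -[z - x]opprB !dotE => h1 h2 _ _; lra.
Qed.

(** The proximal objective is itself a composite one, whose smooth part is an
    exact quadratic. *)
Lemma prox_quad_bounds (a : R) x : a != 0 ->
  quad_bounds a^-1 a^-1 (fun v => (2 * a)^-1 * enorm (v - x) ^+ 2)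
    (fun v => a^-1 *: (v - x)).
Proof.
move=> a0 u v.
have -> : v - x = (v - u) + (u - x) by rewrite addrA subrK.
move: (v - u) (u - x) => d e.
rewrite !enorm_sqr !dotE (dotC d e) invfM.
by split; rewrite le_eqVlt; apply/orP; left; apply/eqP; lra.
Qed.

Variables (a : R) (a0 : 0 < a).

Lemma prox_stationary x :
  stationary g (a^-1 *: (prox a g x - x)) (prox a g x).
Proof.
apply: (argmin_stationary (F := fun v => (2 * a)^-1 * enorm (v - x) ^+ 2)
  (G := fun v => a^-1 *: (v - x)) (mu := a^-1) (L := a^-1)) => //.
  by rewrite invr_gt0.
by apply: prox_quad_bounds; rewrite gt_eqF.
Qed.

Lemma prox_nonexpansive x z : enorm (prox a g x - prox a g z) <= enorm (x - z).
Proof.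
have := stationary_monotone (prox_stationary x) (prox_stationary z).
set p := prox a g x; set q := prox a g z.
rewrite -scalerBr dotZl pmulr_rle0 ?invr_gt0//.
have -> : p - x - (q - z) = (p - q) - (x - z) by apply/rowP => i; rewrite !mxE; ring.
rewrite dotBl -enorm_sqr subr_le0 => h.
have [->|p0] := eqVneq (enorm (p - q)) 0; first exact: enorm_ge0.
rewrite -(@ler_pM2r _ (enorm (p - q))) ?lt_def ?p0 ?enorm_ge0// -expr2.
exact: le_trans h (dot_le_enorm _ _).
Qed.

(** Turns a stationary point into a fixed point of a forward-backward step, to
    measure the distance of the iterates to it, and back. *)
Lemma prox_fixed_point q x :
  stationary g q x <-> prox a g (x - a *: q) = x.
Proof.
have qE u : a^-1 *: (u - (u - a *: q)) = q.
  by rewrite opprB addrC subrK scalerA mulVf ?gt_eqF// scale1r.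
split=> [xs|px]; last first.
  by have := prox_stationary (x - a *: q); rewrite px qE.
have := stationary_monotone (prox_stationary (x - a *: q)) xs.
set p := prox _ _ _.
have -> : a^-1 *: (p - (x - a *: q)) - q = a^-1 *: (p - x).
  rewrite -[X in _ - X = _](qE x) -scalerBr; congr (_ *: _).
  by apply/rowP => i; rewrite !mxE; ring.
rewrite dotZl pmulr_rle0 ?invr_gt0//.
rewrite -enorm_sqr => h.
apply/enorm_dist_eq0/eqP; rewrite -sqrf_eq0 eq_le h; exact: sqr_ge0.
Qed.

End Proper.
End Minimization.

(** * Contraction of the forward-backward steps *)

Section Contraction.
Context {R : realType} {n : nat}.
Implicit Types (F : 'rV[R]_n -> R) (G T S : 'rV[R]_n -> 'rV[R]_n)
  (u v w x z : 'rV[R]_n) (mu L rho : R).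

Lemma quad_bounds_le mu L F G : (0 < n)%N -> quad_bounds mu L F G -> mu <= L.
Proof.
case: n F G => [//|m] F G _ FG.
have [lo up] := FG 0 (delta_mx 0 ord0).
have := le_trans lo up; rewrite lerD2l ler_pM2r ?ler_pM2r ?invr_gt0//.
rewrite exprn_gt0// lt_def enorm_ge0 andbT; apply/eqP => /enorm_eq0 /rowP /(_ ord0).
by rewrite subr0 !mxE !eqxx => /eqP; rewrite oner_eq0.
Qed.

(** Co-coercivity of the gradient of [F - mu/2 |.|^2], which is convex and
    [(L - mu)]-smooth: its lower bound at [x] and its upper bound at [z] are
    compared at a point reached from [z] by a gradient-like step of length [s],
    then symmetrically, and [s] is optimized. *)
Lemma quad_bounds_cocoercive mu L F G x z : mu <= L -> quad_bounds mu L F G ->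
  0 <= dot (G x - G z - mu *: (x - z)) (L *: (x - z) - (G x - G z)).
Proof.
move=> muL FG.
have [d dE] : exists d, d = x - z by exists (x - z).
have [p pE] : exists p, p = G x - G z - mu *: d by eexists.
rewrite -dE -pE.
have -> : L *: d - (G x - G z) = (L - mu) *: d - p.
  by rewrite pE; apply/rowP => i; rewrite !mxE; ring.
have {}pE w : dot p w = dot (G x) w - dot (G z) w - mu * dot d w.
  by rewrite pE !dotE.
have key s : 2 * s * dot p p - dot p d <= (L - mu) * s ^+ 2 * dot p p.
  have [_ up1] := FG z (z + s *: p); have [lo1 _] := FG x (z + s *: p).
  have [_ up2] := FG x (x - s *: p); have [lo2 _] := FG z (x - s *: p).
  have e1 : z + s *: p - z = s *: p by rewrite addrAC subrr add0r.
  have e2 : z + s *: p - x = s *: p - d by rewrite dE; apply/rowP => i; rewrite !mxE; ring.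
  have e3 : x - s *: p - x = - (s *: p) by rewrite addrAC subrr add0r.
  have e4 : x - s *: p - z = d - s *: p by rewrite dE; apply/rowP => i; rewrite !mxE; ring.
  rewrite e1 in up1; rewrite e2 in lo1; rewrite e3 in up2; rewrite e4 in lo2.
  have h1 := le_trans lo1 up1; have h2 := le_trans lo2 up2.
  have := lerD h1 h2.
  rewrite !enorm_sqr !dotE (dotC d p).
  have pp := pE p; have pd := pE d.
  rewrite -subr_ge0 => h3; rewrite -subr_ge0.
  move: h3; rewrite (dotC d p) in pp.
  have -> : dot (G x) p = dot p p + dot (G z) p + mu * dot p d by rewrite pp; ring.
  have -> : dot (G x) d = dot p d + dot (G z) d + mu * dot d d by rewrite pd; ring.
  move=> h3; apply: le_trans h3 _; rewrite le_eqVlt; apply/orP; left; apply/eqP; by field.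
rewrite dotBr dotZr subr_ge0.
have [M0|M0] := eqVneq (L - mu) 0; last first.
  have Mp : 0 < L - mu by rewrite lt_def M0 subr_ge0.
  have := ler_wpM2l (ltW Mp) (key (L - mu)^-1).
  have -> : (L - mu) * ((L - mu) * (L - mu)^-1 ^+ 2 * dot p p) = dot p p by field.
  have -> : (L - mu) * (2 * (L - mu)^-1 * dot p p - dot p d) =
    2 * dot p p - (L - mu) * dot p d by field.
  lra.
rewrite M0 mul0r; rewrite leNgt; apply/negP => p0.
have := key ((dot p d + 1) / (2 * dot p p)); rewrite M0 !mul0r.
have -> : 2 * ((dot p d + 1) / (2 * dot p p)) * dot p p = dot p d + 1.
  by field; rewrite gt_eqF.
lra.
Qed.

(** The gradient increment lies in the ball with diameter from [mu d] to [L d],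
    which [d - beta .] maps onto a ball of center [(1 - beta (L + mu) / 2) d] and
    radius [beta (L - mu) / 2 |d|]. *)
Lemma forward_smooth mu L F G beta x z : mu <= L -> quad_bounds mu L F G ->
  0 <= beta ->
  enorm (x - beta *: G x - (z - beta *: G z)) <= rho_c mu L beta * enorm (x - z).
Proof.
move=> muL FG b0; have := quad_bounds_cocoercive x z muL FG.
have -> : x - beta *: G x - (z - beta *: G z) = (x - z) - beta *: (G x - G z).
  by apply/rowP => i; rewrite !mxE; ring.
move: (x - z) (G x - G z) => d D h.
have d0 : 0 <= enorm d := enorm_ge0 _.
pose e := D - ((L + mu) / 2) *: d.
have ebd : enorm e <= (L - mu) / 2 * enorm d.
  apply: le_enorm_sqr; first by rewrite mulr_ge0// divr_ge0// subr_ge0.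
  move: h; rewrite exprMn enorm_sqr /e !dotE (dotC d D) => h.
  rewrite -subr_ge0; apply: le_trans h _.
  by rewrite le_eqVlt; apply/orP; left; apply/eqP; by field.
have -> : d - beta *: D = (1 - beta * ((L + mu) / 2)) *: d + (- beta) *: e.
  by rewrite /e; apply/rowP => i; rewrite !mxE; ring.
apply: le_trans (enormD _ _) _; rewrite !enormZ normrN (ger0_norm b0).
have : beta * enorm e <= beta * ((L - mu) / 2 * enorm d) by rewrite ler_wpM2l.
set c := 1 - beta * ((L + mu) / 2) => h2.
apply: (@le_trans _ _ ((`|c| + beta * ((L - mu) / 2)) * enorm d)); first lra.
rewrite ler_wpM2r// /rho_c le_max.
have n1 := ler_norm (1 - beta * mu); have n2 := ler_norm (- (1 - beta * L)).
rewrite normrN in n2.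
have [c0|c0] := leP 0 c; apply/orP; [left|right].
  by rewrite ger0_norm//; apply: le_trans n1; rewrite /c; lra.
by rewrite ltr0_norm//; apply: le_trans n2; rewrite /c; lra.
Qed.

(** Expansion of the square: monotonicity bounds the cross term, Lipschitz
    continuity the last one. *)
Lemma forward_monotone mu L T alpha x z :
  strongly_monotone mu T -> elipschitz L T -> 0 <= alpha ->
  enorm (x - alpha *: T x - (z - alpha *: T z)) <= rho_p mu L alpha * enorm (x - z).
Proof.
move=> Tmu TL a0; have := Tmu x z; have := TL x z.
have -> : x - alpha *: T x - (z - alpha *: T z) = (x - z) - alpha *: (T x - T z).
  by apply/rowP => i; rewrite !mxE; ring.
move: (x - z) (T x - T z) => d D h1 h2.
rewrite /rho_p -[enorm d]ger0_norm ?enorm_ge0// -sqrtr_sqr mulrC -sqrtrM ?sqr_ge0//.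
rewrite ler_wsqrtr// !dotE (dotC d D) -!enorm_sqr.
have : enorm D ^+ 2 <= (L * enorm d) ^+ 2.
  by rewrite ler_pXn2r// nnegrE ?enorm_ge0// (le_trans _ h1)// enorm_ge0.
rewrite exprMn => h3.
have : alpha ^+ 2 * enorm D ^+ 2 <= alpha ^+ 2 * (L ^+ 2 * enorm d ^+ 2).
  by rewrite ler_wpM2l// sqr_ge0.
have : alpha * (mu * enorm d ^+ 2) <= alpha * dot D d by rewrite ler_wpM2l.
lra.
Qed.

Lemma zetaE (l : nat) rho : zeta l rho = rho ^+ l.
Proof. by case: l. Qed.

Lemma iter_perturbed_contraction S rho b (l : nat) x xs : 0 <= rho < 1 -> 0 <= b ->
  (forall z, enorm (S z - xs) <= rho * enorm (z - xs) + b) ->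
  enorm (iter l S x - xs) <= zeta l rho * enorm (x - xs) + b / (1 - rho).
Proof.
move=> /andP[r0 r1] b0 hS; rewrite zetaE; elim: l => [|l IH] /=.
  by rewrite expr0 mul1r lerDl divr_ge0// subr_ge0 ltW.
apply: le_trans (hS _) _.
apply: (@le_trans _ _ (rho * (rho ^+ l * enorm (x - xs) + b / (1 - rho)) + b)).
  by rewrite lerD2r ler_wpM2l.
rewrite exprS le_eqVlt; apply/orP; left; apply/eqP; field.
by rewrite subr_eq0 gt_eqF.
Qed.

(** The displacement [|x - S x|] has a minimizer, and it would decrease under
    one more application of [S] if it were not zero there. *)
Lemma contraction_fixed_point S rho : 0 <= rho < 1 -> elipschitz rho S ->
  exists x, S x = x.
Proof.
move=> /andP[r0 r1] hS.
have [x xmin] : exists x, forall v,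
    ((enorm (x - S x))%:E <= (enorm (v - S v))%:E)%E.
  apply: (@coercive_minimizer _ _ (fun x => (enorm (x - S x))%:E)) => r.
    have cS : continuous (fun x => x - S x).
      apply: (@elipschitz_continuous _ _ _ (1 + rho)) => x z.
      have -> : x - S x - (z - S z) = (x - z) + - (S x - S z).
        by apply/rowP => i; rewrite !mxE; ring.
      by rewrite (le_trans (enormD _ _))// enormN mulrDl mul1r lerD2l; exact: hS.
    exact: ((continuous_closedP _).1 (enorm_continuous cS) _ (@closed_le R r)).
  exists ((r + enorm (S 0)) / (1 - rho)) => x; rewrite lee_fin => xr.
  rewrite ler_pdivlMr ?subr_gt0//.
  have t1 := enorm_triangle (S x) x 0; have t2 := enorm_triangle (S 0) (S x) 0.
  have := hS x 0; rewrite !subr0 in t1 t2 * => h; lra.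
exists x; apply/esym/enorm_dist_eq0/eqP; rewrite eq_le enorm_ge0 andbT leNgt.
apply/negP => p0; have := xmin (S x); rewrite lee_fin leNgt => /negP; apply.
by apply: le_lt_trans (hS x (S x)) _; rewrite gtr_pMl.
Qed.

Lemma rho_p_lt1 mu L alpha : 0 < alpha < 2 * mu / L ^+ 2 ->
  0 <= rho_p mu L alpha < 1.
Proof.
move=> /andP[a0 aL]; rewrite sqrtr_ge0/= -[ltRHS]sqrtr1 ltr_sqrt//.
have [L0|L0] := eqVneq L 0.
  by move: aL; rewrite L0 expr0n/= invr0 mulr0 ltNge (ltW a0).
have L2 : 0 < L ^+ 2 by rewrite lt_def sqrf_eq0 L0 sqr_ge0.
rewrite ltr_pdivlMr// -(ltr_pM2l a0) in aL.
lra.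
Qed.

Lemma rho_c_lt1 mu L beta : 0 < mu -> mu <= L -> 0 < beta < 2 / L ->
  0 <= rho_c mu L beta < 1.
Proof.
move=> mu0 muL /andP[b0 bL]; have L0 := lt_le_trans mu0 muL.
rewrite ltr_pdivlMr// in bL.
have bm : 0 < beta * mu by rewrite mulr_gt0.
have bml : beta * mu <= beta * L by rewrite ler_pM2l.
by rewrite /rho_c le_max normr_ge0/= gt_max !ltr_norml; lra.
Qed.

Section Proximal.
Variables (g : 'rV[R]_n -> \bar R) (gP : closed_convex_proper g).

(** Strong monotonicity of [T] against the monotonicity of the subdifferential
    leaves only the defect [T xs - q], paired with [z - xs]. *)
Lemma stationary_perturbation mu T q xs z : 0 < mu -> strongly_monotone mu T ->
  stationary g q xs -> stationary g (T z) z ->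
  enorm (z - xs) <= enorm (T xs - q) / mu.
Proof.
move=> mu0 Tmu sx sz; have := stationary_monotone gP sz sx.
have := Tmu z xs; set d := z - xs => h1.
have -> : T z - q = (T z - T xs) + (T xs - q) by rewrite addrA subrK.
rewrite dotDl => h2.
have := abs_dot_le_enorm (T xs - q) d; rewrite ler_norml => /andP[h3 _].
have [->|d0] := eqVneq (enorm d) 0; first by rewrite divr_ge0 ?enorm_ge0// ltW.
have dp : 0 < enorm d by rewrite lt_def d0 enorm_ge0.
rewrite ler_pdivlMr// -(ler_pM2r dp); lra.
Qed.

(** The iterates contract towards the fixed point of the prediction step, whose
    distance to [xs] is at most [|T xs - q| / mu]; that distance is paid once
    for moving the starting point and once for moving the limit. *)
Lemma prediction_error mu L T alpha (p : nat) q xs x : 0 < mu ->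
  strongly_monotone mu T -> elipschitz L T -> 0 < alpha < 2 * mu / L ^+ 2 ->
  stationary g q xs ->
  enorm (prediction alpha g T p x - xs) <= zeta p (rho_p mu L alpha) * enorm (x - xs)
    + xi p (rho_p mu L alpha) * (enorm (T xs - q) / mu).
Proof.
move=> mu0 Tmu TL ha sx; have /andP[r0 r1] := rho_p_lt1 ha.
have a0 : 0 < alpha by case/andP: ha.
have hS : elipschitz (rho_p mu L alpha) (fun z => prox alpha g (z - alpha *: T z)).
  move=> u v; apply: le_trans (prox_nonexpansive gP a0 _ _) _.
  exact: (forward_monotone _ _ Tmu TL (ltW a0)).
have [z zfix] := contraction_fixed_point (S := fun z => prox alpha g (z - alpha *: T z))
  (introT andP (conj r0 r1)) hS.
have sz : stationary g (T z) z by apply/(prox_fixed_point gP a0).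
have zxs := stationary_perturbation mu0 Tmu sx sz.
case: p => [|p]; first by rewrite /zeta /xi/= mul1r mul0r addr0.
have := @iter_perturbed_contraction _ _ 0 p.+1 x z (introT andP (conj r0 r1)) (lexx 0).
rewrite mul0r addr0 -/(prediction alpha g T p.+1 x) => hit.
have {}hit : enorm (prediction alpha g T p.+1 x - z) <=
    zeta p.+1 (rho_p mu L alpha) * enorm (x - z).
  by apply: hit => v; rewrite addr0 -{1}zfix; exact: hS.
have t1 := enorm_triangle z (prediction alpha g T p.+1 x) xs.
have t2 := enorm_triangle xs x z; rewrite (enormC xs z) in t2.
have q0 : 0 <= rho_p mu L alpha ^+ p.+1 by rewrite exprn_ge0.
rewrite /xi/= zetaE in hit *.
have h3 := ler_wpM2l q0 t2; have h4 := ler_wpM2l q0 zxs; lra.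
Qed.

(** One correction step moves [xs] by at most [beta |G xs - q|], since the step
    with the exact gradient [q] would leave it fixed. *)
Lemma correction_error mu L F G beta (c : nat) q xs x : 0 < mu -> mu <= L ->
  quad_bounds mu L F G -> 0 < beta < 2 / L -> stationary g q xs ->
  enorm (iter c (fun z => prox beta g (z - beta *: G z)) x - xs) <=
    zeta c (rho_c mu L beta) * enorm (x - xs)
    + beta * enorm (G xs - q) / (1 - rho_c mu L beta).
Proof.
move=> mu0 muL FG hb sx; have b0 : 0 < beta by case/andP: hb.
apply: iter_perturbed_contraction => [||z].
- exact: rho_c_lt1.
- by rewrite mulr_ge0 ?enorm_ge0// ltW.
rewrite -{1}((prox_fixed_point gP b0 q xs).1 sx).
apply: le_trans (prox_nonexpansive gP b0 _ _) _.
have -> : z - beta *: G z - (xs - beta *: q) =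
    (z - beta *: G z - (xs - beta *: G xs)) + (- beta) *: (G xs - q).
  by apply/rowP => i; rewrite !mxE; ring.
apply: le_trans (enormD _ _) _; rewrite enormZ normrN (gtr0_norm b0) lerD2r.
exact: (forward_smooth _ _ muL FG (ltW b0)).
Qed.

End Proximal.
End Contraction.

(** * Quadratic bounds of smooth strongly convex functions *)

Section SmoothFunctions.
Context {R : realType} {n : nat}.
Implicit Types (F : 'rV[R]_n -> R) (x z d : 'rV[R]_n) (mu L : R).

Lemma derive_dot_grad F x d : differentiable F x -> 'D_d F x = dot (grad F x) d.
Proof.
move=> dF; rewrite deriveE//.
rewrite [X in 'd F x X](row_sum_delta d) linear_sum/=.
apply: eq_bigr => i _; rewrite linearZ/= /grad mxE deriveE// mulrC.
by [].
Qed.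

Lemma is_derive_line F x d (t : R) : differentiable F (x + t *: d) ->
  is_derive t 1 (fun s : R => F (x + s *: d)) (dot (grad F (x + t *: d)) d).
Proof.
move=> dF; have drv : derivable F (x + t *: d) d by exact: diff_derivable.
have E : (fun h : R => h^-1 *: (((fun s : R => F (x + s *: d)) \o shift t) (h *: (1 : R))
     - F (x + t *: d))) =
  (fun h : R => h^-1 *: ((F \o shift (x + t *: d)) (h *: d) - F (x + t *: d))).
  apply/funext => h /=; congr (_ *: (F _ - _)).
  rewrite [h *: 1](_ : _ = h); last exact: mulr1.
  by rewrite scalerDl addrCA.
apply: DeriveDef; first by rewrite /derivable E.
by rewrite -derive_dot_grad// /derive E.
Qed.

(** Mean value theorem for [s (F (x + t d) - t <grad F x, d>) - (L/2) t^2 |d|^2],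
    with [d = z - x] and a sign [s]: its derivative is nonpositive for [t >= 0]. *)
Lemma smooth_taylor L F x z : (forall x, differentiable F x) -> smooth L F ->
  `|F z - F x - dot (grad F x) (z - x)| <= L / 2 * enorm (z - x) ^+ 2.
Proof.
move=> dF sF; have [d dE] : exists d, d = z - x by eexists.
have zE : z = x + (1 : R) *: d by rewrite dE scale1r addrC subrK.
rewrite -dE.
suff key (s : R) : `|s| = 1 ->
    s * (F z - F x - dot (grad F x) d) <= L / 2 * enorm d ^+ 2.
  rewrite ler_norml; apply/andP; split.
    have := key (-1); rewrite normrN1 => /(_ erefl); lra.
  by have := key 1; rewrite normr1 => /(_ erefl); rewrite mul1r.
move=> s1; pose a := dot (grad F x) d; pose N := enorm d ^+ 2.
pose psi (t : R) := s *: ((F (x + t *: d)) - a *: t) - (L / 2 * N) *: (t * t).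
pose dpsi (t : R) := s * (dot (grad F (x + t *: d)) d - a) - L * N * t.
have dpsiP (t : R) : is_derive t 1 psi (dpsi t).
  have h1 := is_derive_line (dF (x + t *: d)).
  have h2 := is_deriveZ a (is_derive_id t (1:R)).
  have h3 := is_deriveM (is_derive_id t (1:R)) (is_derive_id t (1:R)).
  apply: is_derive_eq (is_deriveB (is_deriveZ s (is_deriveB h1 h2)) (is_deriveZ (L / 2 * N) h3)) _.
  rewrite /dpsi /GRing.scale/=; lra.
have [|c] := MVT ltr01 (fun t _ => dpsiP t).
  apply: continuous_subspaceT => t; apply: differentiable_continuous.
  by apply/derivable1_diffP; case: (dpsiP t).
rewrite in_itv/= => /andP[c0 c1] cE.
have dn : dpsi c <= 0.
  rewrite /dpsi subr_le0; apply: le_trans (ler_norm _) _.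
  rewrite normrM s1 mul1r /a -dotBl (le_trans (abs_dot_le_enorm _ _))//.
  have := sF (x + c *: d) x; rewrite addrAC subrr add0r enormZ gtr0_norm// => h.
  rewrite /N expr2; have := ler_wpM2r (enorm_ge0 d) h; lra.
move: cE; rewrite subr0 mulr1 /psi -zE scale0r addr0 /GRing.scale/= => cE.
rewrite -/a -/N; lra.
Qed.

(** The lower bound compares strong convexity along the segment from [x] to [z]
    with the Taylor expansion at [x], at a small distance from [x]. *)
Lemma strongly_convex_quad_bounds mu L F : (forall x, differentiable F x) ->
  strongly_convex mu F -> smooth L F -> quad_bounds mu L F (grad F).
Proof.
move=> dF cF sF x z; split; last first.
  have := smooth_taylor x z dF sF; rewrite ler_norml => /andP[_]; lra.
have [d dE] : exists d, d = z - x by eexists.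
rewrite -dE -subr_le0.
apply: (@le0_small _ _ (mu / 2 * enorm d ^+ 2 + L / 2 * enorm d ^+ 2)) => t /andP[t0 t1].
have := cF z x t; rewrite (ltW t0) t1 => /(_ isT).
have := smooth_taylor x (x + t *: d) dF sF.
have -> : t *: z + (1 - t) *: x = x + t *: d.
  by rewrite dE; apply/rowP => i; rewrite !mxE; ring.
have -> : x + t *: d - x = t *: d by rewrite addrAC subrr add0r.
rewrite -?dE dotZr enormZ exprMn real_normK ?num_real//.
rewrite ler_norml => /andP[h1 _] h2.
rewrite -(ler_pM2l t0); lra.
Qed.

Lemma quad_bounds_monotone mu L F G : quad_bounds mu L F G -> strongly_monotone mu G.
Proof.
move=> FG x z; have [h1 _] := FG x z; have [h2 _] := FG z x.
rewrite enormC in h1; rewrite dotBl.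
by move: h1; rewrite -(opprB x z) dotNr; lra.
Qed.

End SmoothFunctions.

(** * Random vectors and averaged gradients *)

Section BorelVectors.
Context {R : realType} {n : nat}.

Lemma measurable_borel_rV (h : 'rV[R]_n -> R) : continuous h ->
  measurable_fun [set: borel_rV R n] (h : borel_rV R n -> R).
Proof.
move=> /continuousP ch; apply: (measurability _ (RGenOpens.measurableE R)).
move=> _ [_ [a [b ->] <-]]; rewrite setTI.
by apply: sub_sigma_algebra; apply: ch; exact: interval_open.
Qed.

Lemma measurable_coord (dsp : measure_display) (T : measurableType dsp)
    (f : T -> borel_rV R n) (i : 'I_n) : measurable_fun setT f ->
  measurable_fun setT (fun w => (f w : 'rV[R]_n) 0 i).
Proof.
move=> mf; have h := measurable_borel_rV (@coord_continuous R 1 n 0 i).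
exact: (measurableT_comp h mf).
Qed.

Lemma measurable_enorm (dsp : measure_display) (T : measurableType dsp)
    (f : T -> 'rV[R]_n) : (forall i, measurable_fun setT (fun w => f w 0 i)) ->
  measurable_fun setT (fun w => enorm (f w)).
Proof.
move=> mf; apply: (@measurableT_comp _ _ _ _ _ _ (@Num.sqrt R)).
  by apply: continuous_measurable_fun; exact: sqrt_continuous.
by apply: measurable_sum => i; exact: measurable_funM.
Qed.

Lemma measurable_enormB (dsp : measure_display) (T : measurableType dsp)
    (f : T -> 'rV[R]_n) (v : 'rV[R]_n) :
  (forall i, measurable_fun setT (fun w => f w 0 i)) ->
  measurable_fun setT (fun w => enorm (f w - v)).
Proof.
move=> mf; apply: measurable_enorm => i.
under eq_fun do rewrite !mxE.
by apply: measurable_funB; [exact: mf|exact: measurable_cst].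
Qed.

End BorelVectors.

Section Expectation.
Context {R : realType} {dsp : measure_display} {T : measurableType dsp}
  (P : probability T R).

(** The integral of a nonnegative function is the supremum of the integrals of the
    simple functions below it, hence monotone on arbitrary functions. *)
Lemma expectation_le_majorant (f g : T -> R) :
  (forall w, 0 <= f w) -> (forall w, f w <= g w) ->
  ('E_P[f] <= 'E_P[g])%E.
Proof.
move=> f0 fg; have g0 w : 0 <= g w by exact: le_trans (f0 w) (fg w).
rewrite unlock !ge0_integralTE => [||w]; rewrite ?lee_fin//.
apply: ereal_sup_le => _ [h hf <-]; exists h => //= w.
by apply: le_trans (hf w) _; rewrite lee_fin.
Qed.

Lemma expectationD_le (f g : T -> R) (a b : R) :
  measurable_fun setT f -> measurable_fun setT g ->
  (forall w, 0 <= f w) -> (forall w, 0 <= g w) ->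
  ('E_P[f] <= a%:E)%E -> ('E_P[g] <= b%:E)%E ->
  ('E_P[fun w => (f w + g w)%R] <= (a + b)%:E)%E.
Proof.
move=> mf mg f0 g0; rewrite unlock => fa gb.
rewrite (eq_integral (fun w => (f w)%:E + (g w)%:E)%E)//.
rewrite ge0_integralD// ?EFinD ?leeD//.
- by move=> w _; rewrite lee_fin.
- exact/measurable_EFinP.
- by move=> w _; rewrite lee_fin.
- exact/measurable_EFinP.
Qed.

Lemma expectationZ_le (f : T -> R) (c a : R) : 0 <= c ->
  measurable_fun setT f -> (forall w, 0 <= f w) ->
  ('E_P[f] <= a%:E)%E -> ('E_P[fun w => (c * f w)%R] <= (c * a)%:E)%E.
Proof.
move=> c0 mf f0; rewrite unlock => fa.
rewrite (eq_integral (fun w => c%:E * (f w)%:E)%E)//.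
rewrite ge0_integralZl_EFin// ?EFinM ?lee_wpmul2l ?lee_fin//.
- by move=> w _; rewrite lee_fin.
- exact/measurable_EFinP.
Qed.

Lemma expectation_cst_le (c : R) : ('E_P[fun=> c] <= c%:E)%E.
Proof. by rewrite -[leRHS](expectation_cst P). Qed.

Lemma integrable_cst_prob (c : R) : P.-integrable setT (EFin \o (fun=> c)).
Proof. exact: finite_measure_integrable_cst. Qed.

Lemma Rintegral_cst_prob (c : R) : \int[P]_(w in setT) c = c.
Proof. by rewrite Rintegral_cst//= probability_setT mulr1. Qed.

End Expectation.

Lemma expectation_law {R : realType} {dsp dsp' : measure_display}
  {Omega : measurableType dsp} {T : measurableType dsp'}
  (Pr : probability Omega R) (X : {RV Pr >-> T}) (Q : probability T R)
  (f : T -> R) :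
  (forall B, measurable B -> distribution Pr X B = Q B) ->
  measurable_fun setT f -> (forall y, 0 <= f y) ->
  ('E_Pr[f \o X] = 'E_Q[f])%E.
Proof.
move=> XQ mf f0; rewrite unlock.
rewrite -(@eq_measure_integral _ _ _ setT _ (distribution Pr X) (EFin \o f)).
  by rewrite ge0_integral_distribution//; exact/measurable_EFinP.
by move=> B mB _; exact: XQ.
Qed.

(** Averaging the quadratic bounds of a family requires its field to be measurable
    and integrable in the parameter; these properties come from the functions,
    since the bounds squeeze each component between difference quotients. *)
Section MeanField.
Context {R : realType} {n : nat} {dsp : measure_display} {T : measurableType dsp}
  (Q : probability T R) (f : 'rV[R]_n -> T -> R) (G : T -> 'rV[R]_n -> 'rV[R]_n)
  (mu L : R).
Hypothesis fG : forall v, quad_bounds mu L (f ^~ v) (G v).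
Hypothesis intf : forall x, Q.-integrable setT (EFin \o f x).

Let dir (i : 'I_n) : 'rV[R]_n := delta_mx 0 i.

Let dot_dir (v : 'rV[R]_n) i (s : R) : dot v (s *: dir i) = s * v 0 i.
Proof.
rewrite dotZr /dot (bigD1 i)//= big1 ?addr0.
  by rewrite mxE !eqxx mulr1.
by move=> j ji; rewrite mxE (negbTE ji) andbF mulr0.
Qed.

Let enorm_dir i (s : R) : enorm (s *: dir i) ^+ 2 = s ^+ 2.
Proof. by rewrite enorm_sqr dot_dir !mxE !eqxx mulr1 expr2. Qed.

Let quotient_bounds x v i (s : R) : 0 < s ->
  G v x 0 i + mu / 2 * s <= (f (x + s *: dir i) v - f x v) / s /\
  (f (x + s *: dir i) v - f x v) / s <= G v x 0 i + L / 2 * s.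
Proof.
move=> s0; have [] := fG v x (x + s *: dir i).
have -> : x + s *: dir i - x = s *: dir i by rewrite addrAC subrr add0r.
rewrite dot_dir enorm_dir expr2 ler_pdivlMr// ler_pdivrMr//.
by move=> h1 h2; split; lra.
Qed.

Let intfx x := measurable_int _ (intf x).

Lemma measurable_field x i : measurable_fun setT (fun v => G v x 0 i).
Proof.
apply: (@measurable_fun_cvg _ _ _ _
  (fun m v => (f (x + m.+1%:R^-1 *: dir i) v - f x v) / m.+1%:R^-1)).
  move=> m; apply: measurable_funM; last exact: measurable_cst.
  by apply: measurable_funB; apply/measurable_EFinP; exact: intfx.
move=> v _.
have lin (c : R) : G v x 0 i + c * m.+1%:R^-1 @[m --> \oo] --> G v x 0 i.
  rewrite -[X in _ --> X]addr0 -[X in _ --> _ + X](mulr0 c).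
  by apply: cvgD; [exact: cvg_cst|apply: cvgM; [exact: cvg_cst|exact: cvg_harmonic]].
apply: (squeeze_cvgr _ (lin (mu / 2)) (lin (L / 2))).
apply: nearW => m; have [|h1 h2] := @quotient_bounds x v i m.+1%:R^-1.
  by rewrite invr_gt0.
by rewrite h1 h2.
Qed.

Lemma integrable_field x i : Q.-integrable setT (EFin \o (fun v => G v x 0 i)).
Proof.
pose K := `|mu| / 2 + `|L| / 2.
have intD : Q.-integrable setT (EFin \o (fun v => f (x + 1 *: dir i) v - f x v)).
  exact: (integrableB measurableT (intf _) (intf _)).
apply: (@le_integrable _ _ _ _ _ _ _
  (EFin \o (fun v => `|f (x + 1 *: dir i) v - f x v| + K))) => //.
- by apply/measurable_EFinP; exact: measurable_field.
- move=> v _; rewrite /= lee_fin; apply: le_trans (ler_norm _).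
  have [] := @quotient_bounds x v i 1 ltr01; rewrite divr1 !mulr1 => h1 h2.
  have n1 := ler_norm (f (x + 1 *: dir i) v - f x v).
  have n2 := ler_norm (- (f (x + 1 *: dir i) v - f x v)); rewrite normrN in n2.
  have m1 := ler_norm (- mu); rewrite normrN in m1; have l1 := ler_norm L.
  have m2 := ler_norm mu; have l2 := ler_norm (- L); rewrite normrN in l2.
  have m3 := normr_ge0 mu; have l3 := normr_ge0 L.
  by rewrite ler_norml /K; apply/andP; split; lra.
- apply: (@integrableD _ _ _ _ _ _
    (EFin \o (fun v => `|f (x + 1 *: dir i) v - f x v|)) (EFin \o cst K)) => //.
    exact: (integrable_norm intD).
  exact: integrable_cst_prob.
Qed.

Definition mean x := \int[Q]_(v in setT) f x v.
Definition mean_field x : 'rV[R]_n := \row_i \int[Q]_(v in setT) G v x 0 i.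

Let integrable_component x i (c : R) :
  Q.-integrable setT (EFin \o (fun v => G v x 0 i * c)).
Proof. exact: (integrableZr _ c (integrable_field x i)). Qed.

Let integrable_dot x d : Q.-integrable setT (EFin \o (fun v => dot (G v x) d)).
Proof.
rewrite (_ : EFin \o _ = fun v => (\sum_i (G v x 0 i * d 0 i)%:E)%E).
  by apply: integrable_sum => // i _; exact: integrable_component.
by apply/funext => v; rewrite /= sumEFin.
Qed.

Let Rintegral_dot x d : \int[Q]_(v in setT) dot (G v x) d = dot (mean_field x) d.
Proof.
rewrite /Rintegral; under eq_integral do rewrite -sumEFin.
rewrite integral_sum// => [|i]; last exact: integrable_component.
rewrite (eq_bigr (fun i => (mean_field x 0 i * d 0 i)%:E)); first by rewrite sumEFin.
move=> i _; rewrite mxE -RintegralZr//; last exact: integrable_field.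
rewrite /Rintegral fineK//; apply: integrable_fin_num => //.
exact: integrable_component.
Qed.

Lemma mean_quad_bounds : quad_bounds mu L mean mean_field.
Proof.
move=> x z.
have quadE (c : R) : \int[Q]_(v in setT) (f x v + dot (G v x) (z - x) + c) =
    mean x + dot (mean_field x) (z - x) + c /\
  Q.-integrable setT (EFin \o (fun v => f x v + dot (G v x) (z - x) + c)).
  have i1 : Q.-integrable setT (EFin \o (fun v => f x v + dot (G v x) (z - x))).
    exact: (integrableD measurableT (intf x) (integrable_dot x (z - x))).
  have i2 := integrable_cst_prob Q c.
  split; last exact: (integrableD measurableT i1 i2).
  rewrite (RintegralD measurableT i1 i2).
  rewrite (RintegralD measurableT (intf x) (integrable_dot x (z - x))).
  by rewrite Rintegral_dot Rintegral_cst_prob.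
have [lo ilo] := quadE (mu / 2 * enorm (z - x) ^+ 2).
have [up iup] := quadE (L / 2 * enorm (z - x) ^+ 2).
rewrite -lo -up; split; apply: le_Rintegral => //; try exact: intf.
  by move=> v _; have [] := fG v x z.
by move=> v _; have [] := fG v x z.
Qed.

End MeanField.

(** * The tracking recursion *)

Section MeanGradient.
Context {R : realType} {n d : nat}.
Variables (g : 'rV[R]_n -> \bar R) (gP : closed_convex_proper g).
Variables (f : 'rV[R]_n -> 'rV[R]_d -> R) (mu L : R) (mu0 : 0 < mu).
Hypothesis fG : forall v, quad_bounds mu L (f ^~ v) (grad (f ^~ v)).

Lemma mean_gradE (Q : probability (borel_rV R d) R) x :
  mean_grad f Q x = mean_field Q (fun v => grad (f ^~ v)) x.
Proof. by apply/rowP => i; rewrite !mxE unlock. Qed.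

Lemma mean_grad_quad_bounds (Q : probability (borel_rV R d) R) :
  (forall x, Q.-integrable setT (fun v => (f x v)%:E)) ->
  quad_bounds mu L (mean Q f) (mean_grad f Q).
Proof.
move=> intf; have := mean_quad_bounds (Q := Q) fG intf.
by congr quad_bounds; apply/funext => x; rewrite mean_gradE.
Qed.

Lemma optimizer_stationary (Y : nat -> probability (borel_rV R d) R) k :
  (forall x, (Y k).-integrable setT (fun v => (f x v)%:E)) ->
  stationary g (mean_grad f (Y k) (optimizer f g Y k)) (optimizer f g Y k).
Proof.
move=> intf; apply: (argmin_stationary gP mu0 (mean_grad_quad_bounds intf)) => v.
rewrite addeC; congr (_ + _)%E; rewrite unlock /mean /Rintegral fineK//.
exact: integrable_fin_num (intf v).
Qed.

Lemma measurable_grad_error (Q : probability (borel_rV R d) R) x q :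
  (forall x, Q.-integrable setT (fun v => (f x v)%:E)) ->
  measurable_fun [set: borel_rV R d] (fun v => enorm (grad (f ^~ v) x - q)).
Proof.
by move=> intf; apply: measurable_enormB => i; exact: (measurable_field (Q := Q) fG intf).
Qed.

(** Gives the error of the first iterate a finite expectation, from the
    integrability of the gradient. *)
Lemma grad_error_bounded (Q : probability (borel_rV R d) R) x q :
  (forall x, Q.-integrable setT (fun v => (f x v)%:E)) ->
  exists B : R, ('E_Q[fun v => enorm (grad (f ^~ v) x - q)] <= B%:E)%E.
Proof.
move=> intf.
pose h (v : borel_rV R d) := \sum_i `|grad (f ^~ v) x 0 i - q 0 i|.
have ih : Q.-integrable setT (EFin \o h).
  rewrite (_ : EFin \o _ = fun v => (\sum_i (`|grad (f ^~ v) x 0 i - q 0 i|)%:E)%E).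
    apply: integrable_sum => // i _.
    pose hi (v : borel_rV R d) := grad (f ^~ v) x 0 i - q 0 i.
    have ihi : Q.-integrable setT (EFin \o hi).
      have ig := integrable_field (Q := Q) fG intf x i.
      have ic := integrable_cst_prob Q (q 0 i).

      exact: (integrableB measurableT ig ic).
    exact: (integrable_norm ihi).
  by apply/funext => v; rewrite /= sumEFin.
exists (fine ('E_Q[h])%E); rewrite fineK; last by rewrite unlock; exact: integrable_fin_num.
apply: expectation_le_majorant => v; first exact: enorm_ge0.
by apply: le_trans (enorm_le_sum _) _; apply: ler_sum => i _; rewrite !mxE.
Qed.

End MeanGradient.

Section FilterStep.
Context {R : realType} {n d : nat}.
Variables (g : 'rV[R]_n -> \bar R) (gP : closed_convex_proper g).
Variables (f : 'rV[R]_n -> 'rV[R]_d -> R) (mu L : R) (mu0 : 0 < mu) (muL : mu <= L).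
Hypothesis fG : forall v, quad_bounds mu L (f ^~ v) (grad (f ^~ v)).
Variables (beta chi : R) (c : nat).
Hypotheses (hb : 0 < beta < 2 / L) (hchi : 0 <= chi <= 1).

Lemma filter_step_error q xs xp yv : stationary g q xs ->
  enorm (filter_step beta chi g f c xp yv - xs) <=
  (1 - chi) * enorm (xp - xs) + chi * (zeta c (rho_c mu L beta) * enorm (xp - xs)
    + beta * enorm (grad (f ^~ yv) xs - q) / (1 - rho_c mu L beta)).
Proof.
move=> sx; case/andP: hchi => c0 c1.
have h := correction_error gP c xp mu0 muL (fG yv) hb sx.
rewrite -/(correction beta g f c xp yv) in h.
have -> : filter_step beta chi g f c xp yv - xs =
    (1 - chi) *: (xp - xs) + chi *: (correction beta g f c xp yv - xs).
  by rewrite /filter_step; apply/rowP => i; rewrite !mxE; ring.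
apply: le_trans (enormD _ _) _; rewrite !enormZ (ger0_norm c0) ger0_norm ?subr_ge0//.
by rewrite lerD2l ler_wpM2l.
Qed.

End FilterStep.

Lemma affine_iterE {R : realType} (r c U : R) (j : nat) : r != 1 ->
  iter j (fun t => r * t + c) U = r ^+ j * (U - (1 - r)^-1 * c) + (1 - r)^-1 * c.
Proof.
move=> r1; have r2 : 1 - r != 0 by rewrite subr_eq0 eq_sym.
elim: j => [|j IH]; first by rewrite expr0 /=; ring.
by rewrite iterS IH exprS; field.
Qed.

Lemma limn_esup_affine {R : realType} (u : nat -> \bar R) (r c U : R) :
  0 <= r < 1 -> (forall j, (u j.+1 <= (iter j (fun t => (r * t + c)%R) U)%:E)%E) ->
  (limn_esup u <= ((1 - r)^-1 * c)%:E)%E.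
Proof.
move=> /andP[r0 r1] hu; apply/lee_addgt0Pr => e e0.
have : (fun j => r ^+ j * (U - (1 - r)^-1 * c)) @ \oo --> (0 : R).
  rewrite -[X in _ --> X](mul0r (U - (1 - r)^-1 * c)).
  apply: cvgM; last exact: cvg_cst.
  by apply: cvg_expr; rewrite ger0_norm.
move/cvgrPdist_lt => /(_ e e0) [N _ hN].
apply: (@le_trans _ _ (ereal_sup (u @` [set k | (N < k)%N]))).
  by apply: ereal_inf_lbound; exists [set k | (N < k)%N] => //; exists N.+1.
apply: ge_ereal_sup => _ [[//|k] /= Nk <-].
apply: le_trans (hu k) _; rewrite -EFinD lee_fin affine_iterE ?lt_eqF// addrC lerD2l.
have := hN k Nk; rewrite /= distrC subr0 => /ltW; apply: le_trans; exact: ler_norm.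
Qed.

(** Each error is dominated pointwise by a measurable function of the data: the
    previous majorant is multiplied by [varrho] and receives the drift of the
    optimizer, the predictor error and the gradient noise. The last two are taken
    at the deterministic point [xs k.+1], so their expectations are those bounded
    in the hypotheses whatever the dependence between the data, and expectations
    of majorants add up. *)
Section Tracking.
Context {R : realType} {n d : nat} (n_gt0 : (0 < n)%N)
  {dsp : measure_display} {Omega : measurableType dsp} (Pr : probability Omega R)
  {g : 'rV[R]_n -> \bar R} (g_ccp : closed_convex_proper g)
  (Y : nat -> probability (borel_rV R d) R)
  (y : nat -> {RV Pr >-> borel_rV R d})
  (y_law : forall k (B : set (borel_rV R d)), measurable B ->
     distribution Pr (y k) B = Y k B)
  (mu L : R) (mu_gt0 : 0 < mu)
  (f : 'rV[R]_n -> 'rV[R]_d -> R) (J : nat -> Omega -> 'rV[R]_n -> 'rV[R]_n)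
  (tau sigma Delta : R).
Local Notation xs := (optimizer f g Y).
Hypotheses (fdiff : forall v x, differentiable (f ^~ v) x)
  (intf : forall k, (0 < k)%N -> forall x,
     (Y k).-integrable setT (fun v => (f x v)%:E))
  (mJ : forall k, (0 < k)%N -> forall x i,
     measurable_fun setT (fun w => J k.+1 w x 0 i))
  (H1 : assumption1 mu L f J) (H2 : assumption2 Pr f Y J xs tau sigma)
  (Hdrift : bounded_drift xs Delta).
Variables (alpha beta chi : R) (p c : nat) (x : nat -> Omega -> 'rV[R]_n).
Hypotheses (ha : 0 < alpha < 2 * mu / L ^+ 2) (hb : 0 < beta < 2 / L)
  (hchi : 0 <= chi <= 1)
  (hzeta : zeta c (rho_c mu L beta) * zeta p (rho_p mu L alpha) < 1)
  (hx : generated alpha beta chi g f J p c y x).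

Let fG v : quad_bounds mu L (f ^~ v) (grad (f ^~ v)).
Proof.
have [/(_ v)[cv sm] _] := H1.
exact: strongly_convex_quad_bounds (fdiff v) cv sm.
Qed.

Let muL : mu <= L := quad_bounds_le n_gt0 (fG 0).

Let xs_stationary k : (0 < k)%N -> stationary g (mean_grad f (Y k) (xs k)) (xs k).
Proof. by move=> k0; exact: (optimizer_stationary g_ccp mu_gt0 fG (intf k0)). Qed.

Let noise k w := enorm (grad (f ^~ (y k w)) (xs k) - mean_grad f (Y k) (xs k)).
Let bias k w := enorm (J k w (xs k) - mean_grad f (Y k) (xs k)).

Let measurable_noise k : (0 < k)%N -> measurable_fun setT (noise k).
Proof.
move=> k0; have h := measurable_grad_error fG (xs k) (mean_grad f (Y k) (xs k)) (intf k0).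
exact: (measurableT_comp h (measurable_funPT (y k))).
Qed.

Let expectation_noise k : (0 < k)%N -> ('E_Pr[noise k] =
  'E_(Y k)[fun v => (enorm (grad (f ^~ v) (xs k) - mean_grad f (Y k) (xs k)))%R])%E.
Proof.
move=> k0; apply: (expectation_law (X := y k) (Q := Y k) (y_law k)).
  exact: (measurable_grad_error fG (xs k) (mean_grad f (Y k) (xs k)) (intf k0)).
by move=> v; exact: enorm_ge0.
Qed.

(** The majorant is measurable, so that expectations of majorants are additive;
    the error itself is only compared with it. *)
Let bounded_error k (U : R) := exists u : Omega -> R,
  [/\ measurable_fun setT u, forall w, enorm (x k w - xs k) <= u w &
      ('E_Pr[u] <= U%:E)%E].

Let zp := zeta p (rho_p mu L alpha).
Let zc := zeta c (rho_c mu L beta).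
Let xip := xi p (rho_p mu L alpha).
Let rc := rho_c mu L beta.

Let rc01 : 0 <= rc < 1 := rho_c_lt1 mu_gt0 muL hb.
Let zp01 : 0 <= zp <= 1.
Proof.
have /andP[r0 r1] := rho_p_lt1 ha.
by rewrite /zp zetaE exprn_ge0// exprn_ile1// ltW.
Qed.
Let zc01 : 0 <= zc <= 1.
Proof.
by case/andP: rc01 => r0 r1; rewrite /zc zetaE exprn_ge0// exprn_ile1// ltW.
Qed.
Let xip0 : 0 <= xip.
Proof.
by rewrite /xip /xi; case: ifP => // _; rewrite addr_ge0// exprn_ge0// sqrtr_ge0.
Qed.

Let noise_gain : R := chi * (beta / (1 - rc)).
Let noise_gain0 : 0 <= noise_gain.
Proof.
case/andP: rc01 => _ r1; case/andP: hb => b0 _; case/andP: hchi => c0 _.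
by rewrite mulr_ge0// divr_ge0 ?(ltW b0)// subr_ge0 ltW.
Qed.

Let initial_bound : exists U, bounded_error 1 U.
Proof.
have [B hB] := grad_error_bounded fG (xs 1) (mean_grad f (Y 1) (xs 1)) (intf (ltn0Sn 0)).
pose a := (1 - chi) * enorm (0 - xs 1) + chi * (zc * enorm (0 - xs 1)).
exists (a + noise_gain * B), (fun w => a + noise_gain * noise 1 w); split.
- apply: measurable_funD; first exact: measurable_cst.
  by apply: measurable_funM; [exact: measurable_cst|exact: measurable_noise].
- move=> w; have [-> _] := hx w.
  apply: le_trans (filter_step_error g_ccp mu_gt0 muL fG c hb hchi 0 (y 1 w)
    (xs_stationary (ltn0Sn 0))) _.
  by rewrite /a /noise_gain /noise -/zc -/rc; lra.
- apply: expectationD_le.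
  + exact: measurable_cst.
  + by apply: measurable_funM; [exact: measurable_cst|exact: measurable_noise].
  + case/andP: hchi => c0 c1; case/andP: zc01 => z0 _.
    by move=> _; rewrite /a addr_ge0 ?mulr_ge0 ?enorm_ge0 ?subr_ge0.
  + by move=> w; rewrite mulr_ge0 ?enorm_ge0.
  + exact: expectation_cst_le.
  + apply: expectationZ_le => //; first exact: measurable_noise.
      by move=> w; exact: enorm_ge0.
    by rewrite expectation_noise.
Qed.

Let r := varrho chi zp zc.
Let input := (1 - chi) * (zp * Delta + xip * (tau / mu))
  + chi * (zc * (zp * Delta + xip * (tau / mu)) + beta * sigma / (1 - rc)).

Let step_bound k U : (0 < k)%N -> bounded_error k U ->
  bounded_error k.+1 (r * U + input).
Proof.
move=> k0 [u [mu_ xu Eu]].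
case/andP: hchi => c0 c1; case/andP: zc01 => z0 z1; case/andP: zp01 => q0 q1.
have [_ HJ] := H1; have [hbias hnoise] := H2 k0.
pose w0 := (1 - chi) + chi * zc.
have w00 : 0 <= w0 by rewrite addr_ge0 ?mulr_ge0 ?subr_ge0.
have rE : r = w0 * zp by rewrite /r /w0 /varrho; ring.
have r0 : 0 <= r by rewrite rE mulr_ge0.
pose bias_gain := w0 * (xip / mu).
have bg0 : 0 <= bias_gain by rewrite mulr_ge0// divr_ge0// ltW.
have Delta0 : 0 <= Delta by exact: le_trans (enorm_ge0 _) (Hdrift k0).
have mbias : measurable_fun setT (bias k.+1).
  by apply: measurable_enormB => i; exact: mJ.
exists (fun w => r * u w + (r * Delta + (bias_gain * bias k.+1 w + noise_gain * noise k.+1 w))).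
have m1 : measurable_fun setT (fun w => r * u w).
  by apply: measurable_funM => //; exact: measurable_cst.
have m2 : measurable_fun setT (fun w => bias_gain * bias k.+1 w).
  by apply: measurable_funM => //; exact: measurable_cst.
have m3 : measurable_fun setT (fun w => noise_gain * noise k.+1 w).
  by apply: measurable_funM; [exact: measurable_cst|exact: measurable_noise].
have m4 : measurable_fun setT (fun w => bias_gain * bias k.+1 w + noise_gain * noise k.+1 w).
  exact: measurable_funD.
have m5 : measurable_fun setT
    (fun w => r * Delta + (bias_gain * bias k.+1 w + noise_gain * noise k.+1 w)).
  by apply: measurable_funD => //; exact: measurable_cst.
have u0 w : 0 <= u w := le_trans (enorm_ge0 _) (xu w).
have b0 w : 0 <= bias_gain * bias k.+1 w by rewrite mulr_ge0 ?enorm_ge0.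
have n0 w : 0 <= noise_gain * noise k.+1 w by rewrite mulr_ge0 ?enorm_ge0.
split.
- exact: measurable_funD.
- move=> w; have [_ /(_ k k0) ->] := hx w.
  have [Jm JL] := HJ k k0 w.
  apply: le_trans (filter_step_error g_ccp mu_gt0 muL fG c hb hchi _ (y k.+1 w)
    (xs_stationary (ltn0Sn k))) _.
  have := prediction_error g_ccp p (x k w) mu_gt0 Jm JL ha (xs_stationary (ltn0Sn k)).
  set e := enorm (prediction _ _ _ _ _ - _) => he.
  have t1 := enorm_triangle (xs k) (x k w) (xs k.+1).
  have t2 := Hdrift k0; rewrite enormC in t2.
  have t3 := xu w.
  have he2 : e <= zp * (u w + Delta) + xip * (bias k.+1 w / mu).
    apply: le_trans he _; rewrite lerD2r ler_wpM2l//; lra.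
  have := ler_wpM2l w00 he2.
  rewrite rE /bias_gain /noise_gain /w0 -/zc -/rc -/(noise k.+1 w); lra.
- have -> : r * U + input = r * U + (r * Delta + (bias_gain * tau + noise_gain * sigma)).
    by rewrite rE /input /bias_gain /noise_gain /w0; ring.
  apply: expectationD_le => //.
  + by move=> w; rewrite mulr_ge0.
  + by move=> w; rewrite !addr_ge0// mulr_ge0.
  + exact: expectationZ_le.
  apply: expectationD_le => //.
  + by move=> _; rewrite mulr_ge0.
  + by move=> w; rewrite addr_ge0.
  + exact: expectation_cst_le.
  apply: expectationD_le => //.
  + by apply: expectationZ_le => //; move=> w; exact: enorm_ge0.
  + apply: expectationZ_le => //; first exact: measurable_noise.
      by move=> w; exact: enorm_ge0.
    by rewrite expectation_noise//; exact: hnoise.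
Qed.

Lemma tracking_error_limsup :
  (limn_esup (fun k => 'E_Pr[fun w => (enorm (x k w - xs k))%R])
   <= error_bound mu L alpha beta chi p c Delta (tau / mu) sigma)%E.
Proof.
rewrite /error_bound -/zp -/zc -/xip -/rc -/r -/input.
case: eqVneq => [_|r1]; first by rewrite leey.
case/andP: hchi => c0 c1; case/andP: zc01 => z0 z1; case/andP: zp01 => q0 q1.
have r01 : 0 <= r < 1.
  have zz0 : 0 <= zc * zp by exact: mulr_ge0.
  have h1 : 0 <= (1 - chi) * zp by rewrite mulr_ge0// subr_ge0.
  have h2 : 0 <= chi * (zc * zp) by rewrite mulr_ge0.
  have h3 : (1 - chi) * zp <= (1 - chi) * 1 by rewrite ler_wpM2l// subr_ge0.
  have h4 : chi * (zc * zp) <= chi * 1 by rewrite ler_wpM2l// ltW.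
  rewrite lt_def eq_sym r1 /r /varrho addr_ge0//=; lra.
have [U hU] := initial_bound.
apply: (@limn_esup_affine _ _ _ _ U) => // j.
have [u [_ xu Eu]] : bounded_error j.+1 (iter j (fun t => r * t + input) U).
  by elim: j => // j IH; exact: step_bound.
apply: le_trans Eu; apply: expectation_le_majorant => // w; exact: enorm_ge0.
Qed.

End Tracking.

(** * Moments of Gaussian vectors *)

Section Density.
Context {R : realType} {dsp : measure_display} {T : measurableType dsp}
  (m nu : {measure set T -> \bar R}) (dens : T -> R).
Hypotheses (mdens : measurable_fun setT dens) (dens0 : forall x, 0 <= dens x)
  (nuE : forall A, measurable A -> nu A = (\int[m]_(x in A) (dens x)%:E)%E).

Import HBNNSimple.

(** On a simple function below [f] both sides are finite sums, which agree term by
    term. *)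
Lemma le_integral_density (f : T -> R) :
  measurable_fun setT f -> (forall x, 0 <= f x) ->
  (\int[nu]_x (f x)%:E <= \int[m]_x (f x * dens x)%:E)%E.
Proof.
move=> mf f0; rewrite [leLHS]ge0_integralTE//.
apply: ge_ereal_sup => _ [h /= hf <-].
have mh : measurable_fun setT h by exact: measurable_funPT.
have h0 x : 0 <= h x by [].
apply: (@le_trans _ _ (\int[m]_x (h x * dens x)%:E)%E); last first.
  apply: ge0_le_integral => //.
  - by move=> x _; rewrite lee_fin mulr_ge0.
  - by apply/measurable_EFinP; exact: measurable_funM.
  - by apply/measurable_EFinP; exact: measurable_funM.
  - by move=> x _; rewrite lee_fin ler_wpM2r// -lee_fin hf.
rewrite sintegralE le_eqVlt; apply/orP; left; apply/eqP.
transitivity (\int[m]_x (\sum_(r \in range h)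
    ((r * \1_(h @^-1` [set r]) x)%:E * (dens x)%:E)))%E; last first.
  apply: eq_integral => x _.
  rewrite -ge0_mule_fsuml => [|r]; last exact: nnfun_muleindic_ge0.
  by rewrite fsumEFin// -(fimfunE _ x) EFinM.
have m1 r : measurable_fun setT (fun x => ((r * \1_(h @^-1` [set r]) x)%:E * (dens x)%:E)%E).
  apply/measurable_EFinP; apply: measurable_funM => //.
  by apply: measurable_funM => //; exact: measurable_indic.
rewrite ge0_integral_fsum//; last first.
  by move=> r x _; rewrite mule_ge0 ?lee_fin//; exact: nnfun_muleindic_ge0.
apply: eq_fsbigr => r; rewrite inE => -[x0 _ rE].
have r0 : 0 <= r by rewrite -rE.
rewrite nuE//.
under [RHS]eq_integral do rewrite EFinM -muleA.
rewrite ge0_integralZl_EFin//.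
- congr (_ * _)%E; rewrite integral_mkcond; apply: eq_integral => x _.
  rewrite patchE indicE; case: ifPn => _; by rewrite ?mul1e ?mul0e.
- by move=> x _; rewrite mule_ge0 ?lee_fin.
- apply/measurable_EFinP; apply: measurable_funM => //; exact: measurable_indic.
Qed.

End Density.

Section GaussianMoments.
Context {R : realType}.

(** From [y <= (exp (h y) - 1) / h] at [y = x^2]: the product of the density of
    deviation [s] and of [exp (h x^2)] is, up to the factor [s'/s], the density of
    the larger deviation [s'] determined by [2 h = 1/s^2 - 1/s'^2]. *)
Lemma sqr_normal_pdf_le (s s' x : R) : 0 < s -> s < s' ->
  (s^-1 ^+ 2 - s'^-1 ^+ 2) / 2 * (x ^+ 2 * normal_pdf 0 s x) + normal_pdf 0 s x
    <= s' / s * normal_pdf 0 s' x.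
Proof.
move=> s0 ss'; have s'0 := lt_trans s0 ss'.
set h := (_ - _) / 2.
have peak (t : R) : 0 < t -> normal_peak t = t^-1 * (Num.sqrt (pi *+ 2))^-1.
  move=> t0; rewrite /normal_peak -mulrnAr sqrtrM ?sqr_ge0// sqrtr_sqr gtr0_norm//.
  by rewrite invfM.
rewrite !normal_pdfE ?gt_eqF// /normal_fun !subr0 !peak//.
set q := (Num.sqrt _)^-1; have q0 : 0 <= q by rewrite invr_ge0 sqrtr_ge0.
have -> : expR (- x ^+ 2 / (s' ^+ 2 *+ 2)) = expR (h * x ^+ 2) * expR (- x ^+ 2 / (s ^+ 2 *+ 2)).
  rewrite -expRD; congr expR; rewrite /h -[s' ^+ 2 *+ 2]mulr_natl -[s ^+ 2 *+ 2]mulr_natl.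
  by field; rewrite !gt_eqF.
set E := expR (- _ / _); have E0 : 0 <= E := expR_ge0 _.
have -> : s' / s * (s'^-1 * q * (expR (h * x ^+ 2) * E)) = (s^-1 * q * E) * expR (h * x ^+ 2).
  by field; rewrite !gt_eqF.
have -> : h * (x ^+ 2 * (s^-1 * q * E)) + s^-1 * q * E = (s^-1 * q * E) * (1 + h * x ^+ 2) by ring.
rewrite ler_wpM2l ?expR_ge1Dx//.
by rewrite !mulr_ge0// invr_ge0 ltW.
Qed.

(** Integrating [sqr_normal_pdf_le] bounds the second moment by
    [2 s s'^2 / (s + s')], which is at most [s'^2], for every [s' > s]. *)
Lemma normal_second_moment_le (s : R) : 0 < s ->
  ('E_(normal_prob 0 s)[fun x => (x ^+ 2)%R] <= (s ^+ 2)%:E)%E.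
Proof.
move=> s0; rewrite unlock.
have mX : measurable_fun setT (fun x : R => x ^+ 2) by exact: measurable_funX.
apply: (le_trans (@le_integral_density _ _ _ lebesgue_measure _ (normal_pdf 0 s)
  _ _ _ (fun x => x ^+ 2) _ _)) => //.
- exact: measurable_normal_pdf.
- exact: normal_pdf_ge0.
- by move=> x; exact: sqr_ge0.
set I := integral _ _ _.
have I0 : (0 <= I)%E.
  by apply: integral_ge0 => x _; rewrite lee_fin mulr_ge0 ?sqr_ge0 ?normal_pdf_ge0.
have key (s' : R) : s < s' -> (I <= (s' ^+ 2)%:E)%E.
  move=> ss'; have s'0 := lt_trans s0 ss'.
  pose h := (s^-1 ^+ 2 - s'^-1 ^+ 2) / 2.
  have hE : h = (s' - s) * ((s' + s) / (2 * s ^+ 2 * s' ^+ 2)).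
    by rewrite /h; field; rewrite !gt_eqF.
  have h0 : 0 < h.
    rewrite hE mulr_gt0// ?subr_gt0// divr_gt0// ?addr_gt0//.
    by rewrite !mulr_gt0// exprn_gt0.
  have : (h%:E * I + 1 <= (s' / s)%:E)%E.
    rewrite -[in leLHS](integral_normal_pdf 0 s) -[leRHS]mule1 -(integral_normal_pdf 0 s').
    rewrite -ge0_integralZl_EFin//; last 3 first.
    - by move=> x _; rewrite lee_fin mulr_ge0 ?sqr_ge0 ?normal_pdf_ge0.
    - by apply/measurable_EFinP; apply: measurable_funM => //; exact: measurable_normal_pdf.
    - exact: ltW.
    rewrite -ge0_integralZl_EFin//; last 3 first.
    - by move=> x _; rewrite lee_fin normal_pdf_ge0.
    - by apply/measurable_EFinP; exact: measurable_normal_pdf.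
    - by rewrite divr_ge0 ?ltW.
    have m1 : measurable_fun setT (fun x : R => (h%:E * (x ^+ 2 * normal_pdf 0 s x)%:E)%E).
      apply/measurable_EFinP; apply: measurable_funM => //.
      by apply: measurable_funM => //; exact: measurable_normal_pdf.
    have p1 x : (0 <= h%:E * (x ^+ 2 * normal_pdf 0 s x)%:E)%E.
      by rewrite -EFinM lee_fin mulr_ge0 ?(ltW h0)// mulr_ge0 ?sqr_ge0 ?normal_pdf_ge0.
    have m2 : measurable_fun setT (fun x : R => (normal_pdf 0 s x)%:E).
      by apply/measurable_EFinP; exact: measurable_normal_pdf.
    have p2 x : (0 <= (normal_pdf 0 s x)%:E)%E by rewrite lee_fin normal_pdf_ge0.
    rewrite -ge0_integralD//.
    apply: ge0_le_integral => //.
    - by move=> x _; rewrite adde_ge0.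
    - exact: emeasurable_funD.
    - by apply/measurable_EFinP; apply: measurable_funM => //; exact: measurable_normal_pdf.
    - move=> x _; rewrite -EFinM -EFinD lee_fin; exact: sqr_normal_pdf_le.
  move: I0; case: I => [I| |]//.
    rewrite !lee_fin => I0 hI.
    have {}hI : h * I <= (s' - s) / s.
      have -> : (s' - s) / s = s' / s - 1 by field; rewrite gt_eqF.
      by rewrite lerBrDr.
    have h2 : (s' - s) / s <= h * s' ^+ 2.
      rewrite hE -[leRHS]mulrA ler_pM2l ?subr_gt0//.
      have -> : (s' + s) / (2 * s ^+ 2 * s' ^+ 2) * s' ^+ 2 = s^-1 * ((s' + s) / (2 * s)).
        by field; rewrite !gt_eqF.
      rewrite ler_peMr ?invr_ge0 ?(ltW s0)// ler_pdivlMr ?mulr_gt0//; lra.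
    by rewrite -(ler_pM2l h0) (le_trans hI).
  by move=> _; rewrite gt0_muley ?lte_fin// addye.
apply/lee_addgt0Pr => e e0.
have -> : (s ^+ 2)%:E + e%:E = ((Num.sqrt (s ^+ 2 + e)) ^+ 2)%:E :> \bar R.
  by rewrite sqr_sqrtr// addr_ge0 ?sqr_ge0// ltW.
apply: key; rewrite -[ltLHS]gtr0_norm// -sqrtr_sqr ltr_sqrt ?ltrDl//.
by rewrite addr_gt0// exprn_gt0.
Qed.

Lemma symmetric_mean0 {dsp : measure_display} {Omega : measurableType dsp}
    (Pr : probability Omega R) (Z : Omega -> R) :
  Pr.-integrable setT (EFin \o Z) ->
  (forall B : set R, measurable B -> Pr [set w | B (Z w)] = Pr [set w | B (- Z w)]) ->
  (\int[Pr]_w (Z w)%:E = 0)%E.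
Proof.
move=> iZ symZ.
have mZ : measurable_fun setT Z by apply/measurable_EFinP; exact: measurable_int iZ.
have mN : measurable_fun setT (fun w => - Z w) by exact: measurable_funN.
have iN : Pr.-integrable setT (EFin \o (fun w => - Z w)) by exact: integrableN iZ.
pose X : {RV Pr >-> R} := mfun_Sub (mem_set mZ).
pose X' : {RV Pr >-> R} := mfun_Sub (mem_set mN).
have mid : measurable_fun [set: R] (EFin : R -> \bar R) by apply/measurable_EFinP.
have e1 := integral_distribution (X := X) mid iZ.
have e2 := integral_distribution (X := X') mid iN.
have : (\int[distribution Pr X]_x x%:E = \int[distribution Pr X']_x x%:E)%E.
  by apply: eq_measure_integral => A mA _; exact: symZ.
rewrite e1 e2 /=.
have -> : (\int[Pr]_w (- Z w)%:E = - \int[Pr]_w (Z w)%:E)%E.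
  by rewrite -integralN//; exact: integrable_add_def.
have := integrable_fin_num measurableT iZ.
case: integral => //= r _ [] /eqP; rewrite -subr_eq0 opprK => /eqP rr; congr EFin; lra.
Qed.

End GaussianMoments.

Section Law.
Context {R : realType} {dsp dsp' : measure_display}
  {Omega : measurableType dsp} {T : measurableType dsp'}
  (Pr : probability Omega R) (X : {RV Pr >-> T}) (Q : probability T R) (F : T -> R).
Hypotheses (XQ : forall B, measurable B -> distribution Pr X B = Q B)
  (mF : measurable_fun setT F) (iF : Pr.-integrable setT (EFin \o (F \o X))).

Lemma integrable_law : Q.-integrable setT (EFin \o F).
Proof.
apply/integrableP; split; first exact/measurable_EFinP.
have m : measurable_fun setT (fun v => `|F v|).
  exact: (measurableT_comp (@normr_measurable _ _) mF).
have := expectation_law XQ m (fun v => normr_ge0 (F v)); rewrite unlock /= => <-.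
by case/integrableP: iF.
Qed.

Lemma integral_law : (\int[Q]_v (F v)%:E = \int[Pr]_w (F (X w))%:E)%E.
Proof.
rewrite -(@eq_measure_integral _ _ _ setT _ (distribution Pr X) (EFin \o F)).
  by rewrite integral_distribution//; exact/measurable_EFinP.
by move=> B mB _; exact: XQ.
Qed.

End Law.

Section GaussianVectors.
Context {R : realType} {d : nat} {dsp : measure_display} {Omega : measurableType dsp}
  (Pr : probability Omega R) (X : {RV Pr >-> borel_rV R d}) (S : 'M[R]_d).
Hypothesis gX : gaussian Pr X 0 S.

Let dir (i : 'I_d) : 'rV[R]_d := delta_mx 0 i.

Let dot_dir i (v : 'rV[R]_d) : dot (dir i) v = v 0 i.
Proof.
rewrite /dot (bigD1 i)//= big1 ?addr0; first by rewrite mxE !eqxx mul1r.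
by move=> j ji; rewrite mxE (negbTE ji) andbF mul0r.
Qed.

Let var_dir i : (dir i *m S *m (dir i)^T) 0 0 = S i i.
Proof. by rewrite -rowE trmx_delta -colE !mxE. Qed.

Let var_opp_dir i : (- dir i *m S *m (- dir i)^T) 0 0 = S i i.
Proof. by rewrite linearN/= mulmxN !mulNmx opprK var_dir. Qed.

Lemma gaussian_var_ge0 i : 0 <= S i i.
Proof. by case: gX => _ /(_ (dir i)) + _; rewrite var_dir. Qed.

Lemma measurable_gaussian_coord i : measurable_fun setT (fun w => (X w : 'rV[R]_d) 0 i).
Proof. exact/measurable_coord/measurable_funPT. Qed.

Lemma gaussian_coord_sqr i :
  ('E_Pr[fun w => ((X w : 'rV[R]_d) 0 i ^+ 2)%R] <= (S i i)%:E)%E.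
Proof.
have mZ := measurable_gaussian_coord i.
pose Z : {RV Pr >-> R} := mfun_Sub (mem_set mZ).
have msq : measurable_fun [set: R] (fun x : R => x ^+ 2) by exact: measurable_funX.
have [_ _ /(_ (dir i))] := gX; rewrite var_dir dot0r/= => law.
have v0 := gaussian_var_ge0 i.
have [S0|S0] := eqVneq (S i i) 0.
  rewrite S0 eqxx in law.
  have -> : ('E_Pr[fun w => ((X w : 'rV[R]_d) 0 i ^+ 2)%R] =
      'E_(\d_(0%R : R))[fun x : R => (x ^+ 2)%R])%E.
    apply: (expectation_law (X := Z) (Q := \d_(0%R : R))) => //.
      move=> B mB; rewrite -[RHS]law//; congr (Pr _).
      by apply/seteqP; split => w /=; rewrite dot_dir.
    by move=> x; exact: sqr_ge0.
  rewrite unlock integral_dirac//; last exact/measurable_EFinP.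
  by rewrite expr0n/= mule0 S0.
have -> : ('E_Pr[fun w => ((X w : 'rV[R]_d) 0 i ^+ 2)%R] =
    'E_(normal_prob 0 (Num.sqrt (S i i)))[fun x : R => (x ^+ 2)%R])%E.
  (* the Borel structure of the normal law is carried by [measurableTypeR R] *)
  pose Z' : {RV Pr >-> measurableTypeR R} :=
    @mfun_Sub _ _ Omega (measurableTypeR R) _ (mem_set mZ).
  apply: (@expectation_law _ _ _ _ (measurableTypeR R) Pr Z'
    (normal_prob 0 (Num.sqrt (S i i))) (fun x => x ^+ 2)) => //.
    move=> B mB; rewrite (negbTE S0) in law; rewrite -[RHS]law//; congr (Pr _).
    by apply/seteqP; split => w /=; rewrite dot_dir.
  by move=> x; exact: sqr_ge0.
apply: le_trans (normal_second_moment_le _) _; last by rewrite sqr_sqrtr.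
by rewrite sqrtr_gt0 lt_def S0.
Qed.

Lemma integrable_gaussian_coord i :
  Pr.-integrable setT (EFin \o (fun w => (X w : 'rV[R]_d) 0 i)).
Proof.
have mZ := measurable_gaussian_coord i.
apply/integrableP; split; first exact/measurable_EFinP.
have /le_lt_trans : ('E_Pr[fun w => `|(X w : 'rV[R]_d) 0 i|%R] <= (1 + S i i)%:E)%E.
  have msq : measurable_fun setT (fun w => (X w : 'rV[R]_d) 0 i ^+ 2).
    exact: measurable_funX.
  have mone : measurable_fun setT (fun _ : Omega => 1 : R) by exact: measurable_cst.
  have := expectationD_le mone msq (fun=> ler01) (fun w => sqr_ge0 _)
    (expectation_cst_le Pr 1) (gaussian_coord_sqr i).
  apply: le_trans; apply: expectation_le_majorant => // w.
  set z := (X w : 'rV[R]_d) 0 i.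
  have := sqr_ge0 (`|z| - 1); rewrite -(real_normK (num_real z)); nra.
by rewrite unlock; apply; exact: ltry.
Qed.

(** The projections of a centered Gaussian vector on opposite directions have
    the same law. *)
Lemma gaussian_coord_mean i : (\int[Pr]_w ((X w : 'rV[R]_d) 0 i)%:E = 0)%E.
Proof.
apply: symmetric_mean0; first exact: integrable_gaussian_coord.
have [_ _ law] := gX => B mB.
have := law (dir i) B mB; have := law (- dir i) B mB.
rewrite var_dir var_opp_dir /= !dot0r => <-.
have -> : [set w | B (dot (dir i) (X w))] = [set w | B ((X w : 'rV[R]_d) 0 i)].
  by apply/seteqP; split => w /=; rewrite dot_dir.
move=> ->; congr (Pr _).
by apply/seteqP; split => w /=; rewrite dotNl dot_dir.
Qed.

Lemma expectation_sum_le (I : Type) (s : seq I) (h : I -> Omega -> R) (a : I -> R) :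
  (forall i, measurable_fun setT (h i)) -> (forall i w, 0 <= h i w) ->
  (forall i, ('E_Pr[h i] <= (a i)%:E)%E) ->
  ('E_Pr[fun w => (\sum_(i <- s) h i w)%R] <= (\sum_(i <- s) a i)%:E)%E.
Proof.
move=> mh h0 ha; elim: s => [|i s IH].
  by under eq_fun do rewrite big_nil; rewrite big_nil; exact: expectation_cst_le.
under eq_fun do rewrite big_cons; rewrite big_cons.
apply: expectationD_le => //; first exact: measurable_sum.
by move=> w; apply: sumr_ge0.
Qed.

(** Jensen's inequality for the square, in the form
    [|x| <= s / 2 + |x|^2 / (2 s)] with [s] decreasing to the bound. *)
Lemma gaussian_enorm_le (b : R) : Num.sqrt (\tr S) <= b ->
  ('E_Pr[fun w => (enorm (X w : 'rV[R]_d))%R] <= b%:E)%E.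
Proof.
move=> trb; have b0 : 0 <= b := le_trans (sqrtr_ge0 _) trb.
have tr0 : 0 <= \tr S by apply: sumr_ge0 => i _; exact: gaussian_var_ge0.
have {}trb : \tr S <= b ^+ 2.
  by rewrite -(sqr_sqrtr tr0) ler_pXn2r// nnegrE sqrtr_ge0.
have msq i : measurable_fun setT (fun w => (X w : 'rV[R]_d) 0 i ^+ 2).
  by apply: measurable_funX; exact: measurable_gaussian_coord.
have sq : ('E_Pr[fun w => (\sum_i (X w : 'rV[R]_d) 0 i ^+ 2)%R] <= (\tr S)%:E)%E.
  apply: expectation_sum_le => // [i w|i]; first exact: sqr_ge0.
  exact: gaussian_coord_sqr.
apply/lee_addgt0Pr => e e0; set s := b + e.
have s0 : 0 < s by rewrite ltr_wpDl.
have i2 : 0 <= (2 * s)^-1 by rewrite invr_ge0 mulr_ge0// ltW.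
apply: (@le_trans _ _ (s / 2 + (2 * s)^-1 * \tr S)%:E); last first.
  rewrite -EFinD lee_fin -/s.
  have : (2 * s)^-1 * \tr S <= (2 * s)^-1 * s ^+ 2.
    rewrite ler_wpM2l// (le_trans trb)// ler_pXn2r// ?nnegrE ?(ltW s0)//.
    by rewrite lerDl ltW.
  have -> : (2 * s)^-1 * s ^+ 2 = s / 2 by field; rewrite gt_eqF.
  lra.
have m1 : measurable_fun setT (fun w => \sum_i (X w : 'rV[R]_d) 0 i ^+ 2).
  exact: measurable_sum.
have p1 w : 0 <= \sum_i (X w : 'rV[R]_d) 0 i ^+ 2.
  by apply: sumr_ge0 => i _; exact: sqr_ge0.
have m2 : measurable_fun setT (fun w => (2 * s)^-1 * \sum_i (X w : 'rV[R]_d) 0 i ^+ 2).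
  by apply: measurable_funM => //; exact: measurable_cst.
have s2 : 0 <= s / 2 by rewrite divr_ge0// ltW.
have mc : measurable_fun setT (fun _ : Omega => s / 2) by exact: measurable_cst.
have := expectationD_le mc m2 (fun=> s2)
  (fun w => mulr_ge0 i2 (p1 w)) (expectation_cst_le Pr _) (expectationZ_le i2 m1 p1 sq).
apply: le_trans; apply: expectation_le_majorant => w; first exact: enorm_ge0.
have -> : \sum_i (X w : 'rV[R]_d) 0 i ^+ 2 = enorm (X w : 'rV[R]_d) ^+ 2.
  by rewrite enorm_sqr /dot; apply: eq_bigr => i _; rewrite expr2.
set z := enorm _.
have -> : s / 2 + (2 * s)^-1 * z ^+ 2 = z + (2 * s)^-1 * (s - z) ^+ 2.
  by field; rewrite gt_eqF.
by rewrite lerDl mulr_ge0// sqr_ge0.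
Qed.

End GaussianVectors.

(** * Linear costs and smooth trajectories *)

Section OperatorNorm.
Context {R : realType}.

Lemma dot_mx (m : nat) (u v : 'rV[R]_m) : dot u v = (u *m v^T) 0 0.
Proof. by rewrite mxE; apply: eq_bigr => i _; rewrite mxE. Qed.

Lemma dot_adjoint (d n : nat) (A : 'M[R]_(d, n)) v x :
  dot (v *m A) x = dot v (x *m A^T).
Proof. by rewrite !dot_mx trmx_mul trmxK mulmxA. Qed.

Context {d n : nat} (A : 'M[R]_(d, n)).

Let image_ball := [set enorm (x *m A^T) | x in [set x : 'rV[R]_n | enorm x <= 1]].

Let has_sup_image_ball : has_sup image_ball.
Proof.
split; first by exists (enorm ((0 : 'rV[R]_n) *m A^T)), 0 => //=; rewrite enorm0 ler01.
exists (\sum_j \sum_i `|A j i|) => _ [x /= x1 <-].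
apply: le_trans (enorm_le_sum _) _; apply: ler_sum => j _.
rewrite mxE; apply: le_trans (ler_norm_sum _ _ _) _; apply: ler_sum => i _.
rewrite !mxE normrM ler_piMl//; exact: le_trans (coord_le_enorm _ _) x1.
Qed.

Lemma opnorm_ge0 : 0 <= opnorm A.
Proof.
apply: ub_le_sup; first by case: has_sup_image_ball.
by exists 0; rewrite /= ?mul0mx ?enorm0 ?ler01.
Qed.

Lemma enorm_mulmx_tr x : enorm (x *m A^T) <= opnorm A * enorm x.
Proof.
have [x0|x0] := eqVneq (enorm x) 0.
  by rewrite (enorm_eq0 x0) mul0mx !enorm0 mulr0.
have xp : 0 < enorm x by rewrite lt_def x0 enorm_ge0.
have : enorm (((enorm x)^-1 *: x) *m A^T) <= opnorm A.
  apply: ub_le_sup; first by case: has_sup_image_ball.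
  exists ((enorm x)^-1 *: x) => //=.
  by rewrite enormZ gtr0_norm ?invr_gt0// mulVf.
by rewrite -scalemxAl enormZ gtr0_norm ?invr_gt0// mulrC ler_pdivrMr.
Qed.

(** The adjoint has the same norm: [|v A|^2 = <v, (v A) A^T>]. *)
Lemma enorm_mulmx v : enorm (v *m A) <= opnorm A * enorm v.
Proof.
have [->|x0] := eqVneq (enorm (v *m A)) 0.
  by rewrite mulr_ge0 ?opnorm_ge0 ?enorm_ge0.
have xp : 0 < enorm (v *m A) by rewrite lt_def x0 enorm_ge0.
rewrite -(ler_pM2r xp) -expr2 enorm_sqr dot_adjoint.
apply: le_trans (dot_le_enorm _ _) _.
have := ler_wpM2l (enorm_ge0 v) (enorm_mulmx_tr (v *m A)); lra.
Qed.

End OperatorNorm.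

Section LinearForms.
Context {R : realType} {n : nat}.

Lemma dot_is_linear (u : 'rV[R]_n) : linear (dot u : 'rV[R]_n -> R^o).
Proof. by move=> a x z; rewrite !dotE. Qed.

HB.instance Definition _ (u : 'rV[R]_n) :=
  GRing.isLinear.Build R 'rV[R]_n R^o *:%R (dot u) (dot_is_linear u).

Lemma dotr_continuous (u : 'rV[R]_n) : continuous (dot u).
Proof.
by apply: (@dot_continuous _ _ _ (fun=> u) id); [exact: cst_continuous|move=> x; exact: cvg_id].
Qed.

Lemma is_derive_dot (u : 'rV[R]_n) (F : R -> 'rV[R]_n) (t : R) dF :
  is_derive t 1 F dF -> is_derive t 1 (fun s => dot u (F s)) (dot u dF).
Proof.
move=> [drv val].
have dfF : differentiable F t by apply/derivable1_diffP.
have dfu x : differentiable (dot u : 'rV[R]_n -> R^o) x.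
  exact/linear_differentiable/dotr_continuous.
apply: DeriveDef.
  by apply/derivable1_diffP; exact: differentiable_comp.
rewrite deriveE; last exact: differentiable_comp.
rewrite (_ : (fun s => dot u (F s)) = (dot u : 'rV[R]_n -> R^o) \o F)//.
rewrite diff_comp//= diff_lin; last exact: dotr_continuous.
by rewrite -val deriveE.
Qed.

(** The scalar mean value theorem for the component of [F] along the increment
    [F b - F a]. *)
Lemma mean_value_enorm (F dF : R -> 'rV[R]_n) (C a b : R) : a < b ->
  (forall t : R, is_derive t 1 F (dF t)) -> (forall t : R, enorm (dF t) <= C) ->
  enorm (F b - F a) <= C * (b - a).
Proof.
move=> ab drv dC; set u := F b - F a.
have drvu (t : R) : is_derive t 1 (fun s => dot u (F s)) (dot u (dF t)) by exact: is_derive_dot.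
have [|c _] := MVT ab (fun t _ => drvu t).
  apply: continuous_subspaceT => t; apply: differentiable_continuous.
  by apply/derivable1_diffP; case: (drvu t).
rewrite -dotBr -/u -enorm_sqr => uE.
have [->|u0] := eqVneq (enorm u) 0.
  by rewrite mulr_ge0 ?subr_ge0 ?(ltW ab)// (le_trans (enorm_ge0 (dF 0))).
have up : 0 < enorm u by rewrite lt_def u0 enorm_ge0.
rewrite -(ler_pM2l up) -expr2 uE mulrA ler_wpM2r ?subr_ge0 ?(ltW ab)//.
by apply: le_trans (dot_le_enorm _ _) _; rewrite ler_wpM2l// enorm_ge0.
Qed.

Lemma is_derive_shift (F : R -> 'rV[R]_n) (h t : R) dF :
  is_derive (t + h) 1 F dF -> is_derive t 1 (fun s => F (s + h)) dF.
Proof.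
move=> [drv val].
have E : (fun k : R => k^-1 *: (((fun s : R => F (s + h)) \o shift t) (k *: (1 : R)) - F (t + h)))
    = (fun k : R => k^-1 *: ((F \o shift (t + h)) (k *: (1 : R)) - F (t + h))).
  by apply/funext => k /=; rewrite addrA.
by apply: DeriveDef; [rewrite /derivable E|rewrite -val /derive E].
Qed.

(** The mean value inequality for [s |-> F (s + h) - F s] on [[t - h, t]], whose
    derivative is bounded by the same inequality applied to [F']. *)
Lemma second_difference_enorm (F : R -> 'rV[R]_n) (C h t : R) : 0 < h ->
  (forall s : R, derivable F s 1) -> (forall s : R, derivable (derive1 F) s 1) ->
  (forall s : R, enorm (derive1 (derive1 F) s) <= C) ->
  enorm (F (t + h) - F t - (F t - F (t - h))) <= C * h ^+ 2.
Proof.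
move=> h0 d1 d2 dC.
have D1 (s : R) : is_derive s 1 F (derive1 F s) by rewrite derive1E; exact/derivableP.
have D2 (s : R) : is_derive s 1 (derive1 F) (derive1 (derive1 F) s).
  by rewrite (derive1E (derive1 F)); exact/derivableP.
have D3 (s : R) : is_derive s 1 (fun r => F (r + h) - F r) (derive1 F (s + h) - derive1 F s).
  exact: is_deriveB (is_derive_shift (D1 (s + h))) (D1 s).
have th : t - h < t by rewrite ltrBlDr ltrDl.
have := mean_value_enorm (C := C * h) th D3.
have -> : t - (t - h) = h by ring.
rewrite /= subrK expr2 mulrA; apply => s.
have := mean_value_enorm _ D2 dC (a := s) (b := s + h).
by rewrite ltrDl addrAC subrr add0r; apply.
Qed.

End LinearForms.

Section LinearCost.
Context {R : realType} {n d : nat} (f' : 'rV[R]_n -> R) (A : 'M[R]_(d, n)).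
Hypothesis df' : forall x, differentiable f' x.

Lemma linear_costE v : (linear_cost f' A) ^~ v = f' \+ dot (v *m A).
Proof. by apply/funext => x; rewrite /linear_cost/= dot_mx. Qed.

Let ddot (u x : 'rV[R]_n) : differentiable (dot u) x.
Proof. exact/(@linear_differentiable _ _ R^o)/dotr_continuous. Qed.

Lemma differentiable_linear_cost v x : differentiable ((linear_cost f' A) ^~ v) x.
Proof. by rewrite linear_costE; apply: differentiableD. Qed.

Lemma grad_linear_cost v x : grad ((linear_cost f' A) ^~ v) x = grad f' x + v *m A.
Proof.
apply/rowP => i; rewrite linear_costE /grad !mxE deriveE; last exact: differentiableD.
rewrite diffD//= deriveE//; congr (_ + _).
rewrite (@diff_lin _ _ R^o); last exact: dotr_continuous.
by rewrite /= dot_adjoint dot_mx trmx_mul trmxK mulmxA trmx_delta -colE !mxE.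
Qed.

Lemma linear_cost_strongly_convex mu v :
  strongly_convex mu f' -> strongly_convex mu ((linear_cost f' A) ^~ v).
Proof.
move=> cv x z t t01; rewrite /linear_cost -!dot_mx !dotE.
by have := cv x z t t01; lra.
Qed.

Lemma linear_cost_smooth L v : smooth L f' -> smooth L ((linear_cost f' A) ^~ v).
Proof.
move=> sm x z; rewrite !grad_linear_cost opprD addrACA subrr addr0; exact: sm.
Qed.

End LinearCost.

(** * The linear-Gaussian setting *)

(** All gradients at a point differ by a term [v A], where [v] depends on the data
    alone: each constant is [C0] times a bound on the corresponding [v], divided by
    [mu] when it measures a displacement of the optimizer. *)
Section LinearGaussian.
Context {R : realType} {n d : nat} (n_gt0 : (0 < n)%N)
  {dsp : measure_display} {Omega : measurableType dsp} (Pr : probability Omega R)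
  {g : 'rV[R]_n -> \bar R} (g_ccp : closed_convex_proper g)
  (Y : nat -> probability (borel_rV R d) R)
  (y : nat -> {RV Pr >-> borel_rV R d})
  (y_law : forall k (B : set (borel_rV R d)), measurable B ->
     distribution Pr (y k) B = Y k B)
  (mu L : R) (mu_gt0 : 0 < mu)
  (f' : 'rV[R]_n -> R) (A : 'M[R]_(d, n)) (C0 C h Sigma : R)
  (t : nat -> R) (ybar : R -> 'rV[R]_d)
  (e : nat -> {RV Pr >-> borel_rV R d}) (Sg : nat -> 'M[R]_d).
Local Notation f := (linear_cost f' A).
Local Notation J := (two_point f y).
Local Notation xs := (optimizer f g Y).
Local Notation E k w := (e k w : 'rV[R]_d).
Hypotheses (df' : forall x, differentiable f' x)
  (cv' : strongly_convex mu f') (sm' : smooth L f') (AC0 : opnorm A <= C0)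
  (h0 : 0 < h) (th : forall k, t k.+1 - t k = h)
  (dy : forall s : R, derivable ybar s 1)
  (ddy : forall s : R, derivable (derive1 ybar) s 1)
  (dyC : forall s : R, enorm (derive1 ybar s) <= C)
  (ddyC : forall s : R, enorm (derive1 (derive1 ybar) s) <= C)
  (ge : forall k, gaussian Pr (e k) 0 (Sg k))
  (trS : forall k, Num.sqrt (\tr (Sg k)) <= Sigma)
  (yE : forall k w, y k w = (ybar (t k) + e k w : 'rV[R]_d)).

Let C00 : 0 <= C0 := le_trans (opnorm_ge0 A) AC0.

Let mulA_le v : enorm (v *m A) <= C0 * enorm v.
Proof.
by apply: le_trans (enorm_mulmx A v) _; rewrite ler_wpM2r// enorm_ge0.
Qed.

Let integrable_noise_form k (u : 'rV[R]_d) :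
  Pr.-integrable setT (EFin \o (fun w => dot (E k w) u)).
Proof.
rewrite (_ : EFin \o _ = fun w => (\sum_i (E k w 0 i * u 0 i)%:E)%E).
  apply: integrable_sum => // i _.
  exact: (integrableZr _ _ (integrable_gaussian_coord (ge k) i)).
by apply/funext => w; rewrite /= sumEFin.
Qed.

Let mean_noise_form k (u : 'rV[R]_d) : (\int[Pr]_w (dot (E k w) u)%:E = 0)%E.
Proof.
under eq_integral do rewrite -sumEFin.
rewrite integral_sum// => [|i]; last first.
  exact: (integrableZr _ _ (integrable_gaussian_coord (ge k) i)).
rewrite big1// => i _.
under eq_integral do rewrite EFinM.
rewrite integralZr//; last exact: integrable_gaussian_coord (ge k) i.
by rewrite (gaussian_coord_mean (ge k)) mul0e.
Qed.

(** The datum is the nominal one plus centered integrable noise. *)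
Let affine_datum k (a : R) (u : 'rV[R]_d) :
  (Y k).-integrable setT (EFin \o (fun v : borel_rV R d => a + dot (v : 'rV[R]_d) u)) /\
  (\int[Y k]_v (a + dot (v : 'rV[R]_d) u)%:E = (a + dot (ybar (t k)) u)%:E)%E.
Proof.
have mF : measurable_fun [set: borel_rV R d] (fun v : borel_rV R d => a + dot (v : 'rV[R]_d) u).
  apply: measurable_funD; first exact: measurable_cst.
  apply: measurable_borel_rV.
  by apply: (@dot_continuous _ _ _ id (fun=> u)); [move=> v; exact: cvg_id|exact: cst_continuous].
have FE : (fun v : borel_rV R d => a + dot (v : 'rV[R]_d) u) \o y k =
    (fun w => (a + dot (ybar (t k)) u) + dot (E k w) u).
  by apply/funext => w; rewrite /= yE dotDl addrA.
have ic : Pr.-integrable setT (EFin \o (fun _ : Omega => a + dot (ybar (t k)) u)).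
  exact: integrable_cst_prob.
have iF : Pr.-integrable setT (EFin \o ((fun v : borel_rV R d => a + dot (v : 'rV[R]_d) u) \o y k)).
  by rewrite FE; exact: (integrableD measurableT ic (integrable_noise_form k u)).
split; first exact: (integrable_law (y_law k) mF iF).
rewrite (integral_law (y_law k) mF iF).
under eq_integral => w _.
  rewrite (_ : (a + _)%:E = ((a + dot (ybar (t k)) u)%:E + (dot (E k w) u)%:E)%E); last first.
    by rewrite yE dotDl addrA EFinD.
  over.
rewrite integralD//=; last exact: integrable_noise_form.
by rewrite mean_noise_form adde0 integral_cst//= probability_setT mule1.
Qed.

Let integrable_cost k x : (Y k).-integrable setT (fun v => (f x v)%:E).
Proof.
have [+ _] := affine_datum k (f' x) (x *m A^T).
rewrite (_ : EFin \o _ = (fun v => (f x v)%:E))//.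
by apply/funext => v /=; rewrite /linear_cost -dot_mx dot_adjoint.
Qed.

Let mean_gradient k x : mean_grad f (Y k) x = grad f' x + ybar (t k) *m A.
Proof.
have entry v i : (v *m A) 0 i = dot v (delta_mx 0 i *m A^T) :> R.
  by rewrite -dot_adjoint dot_mx trmx_delta -colE [RHS]mxE.
apply/rowP => i; rewrite mxE [RHS]mxE entry unlock.
have [_ /(congr1 fine) /= <-] := affine_datum k (grad f' x 0 i) (delta_mx 0 i *m A^T).
by congr fine; apply: eq_integral => v _; rewrite grad_linear_cost// mxE entry.
Qed.

Let fG v : quad_bounds mu L (f ^~ v) (grad (f ^~ v)).
Proof.
apply: strongly_convex_quad_bounds.
- by move=> x; exact: differentiable_linear_cost.
- exact: linear_cost_strongly_convex.
- exact: linear_cost_smooth.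
Qed.

Let two_pointE k w x : J k w x = grad f' x + (2 *: y k.-1 w - y k.-2 w) *m A.
Proof.
rewrite /two_point !grad_linear_cost// mulmxBl -scalemxAl.
move: (grad f' x) (_ *m A) (_ *m A) => a b c.
by apply/rowP => i; rewrite !mxE; ring.
Qed.

Lemma linear_gaussian_assumption1 : assumption1 mu L f J.
Proof.
split.
  by move=> v; split; [exact: linear_cost_strongly_convex|exact: linear_cost_smooth].
move=> k _ w.
have JB x z : J k.+1 w x - J k.+1 w z = grad f' x - grad f' z.
  by rewrite !two_pointE opprD addrACA subrr addr0.
have fG' : quad_bounds mu L f' (grad f') by exact: strongly_convex_quad_bounds.
split=> x z; rewrite JB; last exact: sm'.
exact: (quad_bounds_monotone fG').
Qed.

Let measurable_predictor k : (0 < k)%N -> forall x i,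
  measurable_fun setT (fun w => J k.+1 w x 0 i).
Proof.
move=> k0 x i.
have mg j : measurable_fun setT (fun w => grad (f ^~ (y j w)) x 0 i).
  have mf := measurable_field (Q := Y j) fG (integrable_cost j) x i.
  exact: (measurableT_comp mf (measurable_funPT (y j))).
rewrite (_ : (fun w => _) = (fun w =>
    2 * grad (f ^~ (y k w)) x 0 i - grad (f ^~ (y k.-1 w)) x 0 i)); last first.
  by apply/funext => w; rewrite /two_point !mxE.
apply: measurable_funB; last exact: mg.
by apply: measurable_funM; [exact: measurable_cst|exact: mg].
Qed.

Let measurable_noise k : measurable_fun setT (fun w => enorm (E k w)).
Proof. by apply: measurable_enorm => i; exact: measurable_gaussian_coord. Qed.

Let noise_le k : ('E_Pr[fun w => enorm (E k w)] <= Sigma%:E)%E.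
Proof. exact: (gaussian_enorm_le (ge k) (trS k)). Qed.

Lemma linear_gaussian_assumption2 :
  assumption2 Pr f Y J xs (C0 * C * h ^+ 2 + 3 * C0 * Sigma) (C0 * Sigma).
Proof.
move=> k k0; split => [|x]; last first.
  have m : measurable_fun [set: borel_rV R d]
      (fun v => enorm (grad (f ^~ v) x - mean_grad f (Y k.+1) x)).
    exact: (measurable_grad_error fG x (mean_grad f (Y k.+1) x) (integrable_cost k.+1)).
  rewrite -(expectation_law (y_law k.+1) m (fun v => enorm_ge0 _)).
  apply: le_trans (expectationZ_le C00 (measurable_noise k.+1)
    (fun w => enorm_ge0 _) (noise_le k.+1)).
  apply: expectation_le_majorant => w /=; first exact: enorm_ge0.
  rewrite mean_gradient grad_linear_cost// opprD addrACA subrr add0r -mulmxBl yE.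
  by rewrite addrAC subrr add0r; exact: mulA_le.
have mz k' (c : R) : measurable_fun setT (fun w => c * enorm (E k' w)).
  by apply: measurable_funM; [exact: measurable_cst|exact: measurable_noise].
have c20 : 0 <= 2 * C0 by rewrite mulr_ge0.
have bias0 : 0 <= C0 * (C * h ^+ 2).
  by rewrite mulr_ge0// mulr_ge0 ?sqr_ge0// (le_trans (enorm_ge0 _) (dyC 0)).
have -> : C0 * C * h ^+ 2 + 3 * C0 * Sigma =
    C0 * (C * h ^+ 2) + ((2 * C0) * Sigma + C0 * Sigma) by ring.
have pz k' (c : R) : 0 <= c -> forall w, 0 <= c * enorm (E k' w).
  by move=> c0 w; rewrite mulr_ge0 ?enorm_ge0.
have m2 : measurable_fun setT (fun w => 2 * C0 * enorm (E k w) + C0 * enorm (E k.-1 w)).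
  exact: measurable_funD.
have mc : measurable_fun setT (fun _ : Omega => C0 * (C * h ^+ 2)) by exact: measurable_cst.
have p2 w : 0 <= 2 * C0 * enorm (E k w) + C0 * enorm (E k.-1 w).
  by rewrite addr_ge0 ?pz.
apply: le_trans (expectationD_le mc m2 (fun=> bias0) p2 (expectation_cst_le Pr _)
  (expectationD_le (mz k (2 * C0)) (mz k.-1 C0) (pz k _ c20) (pz k.-1 _ C00)
    (expectationZ_le c20 (measurable_noise k) (fun w => enorm_ge0 _) (noise_le k))
    (expectationZ_le C00 (measurable_noise k.-1) (fun w => enorm_ge0 _) (noise_le k.-1)))).
apply: expectation_le_majorant => w; first exact: enorm_ge0.
rewrite two_pointE mean_gradient opprD addrACA subrr add0r -mulmxBl /= !yE.
apply: le_trans (mulA_le _) _.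
set v := (X in enorm X).
(* the extrapolation error of the nominal trajectory is a second difference *)
pose a := ybar (t k + h) - ybar (t k) - (ybar (t k) - ybar (t k - h)).
have -> : v = - a + (2 *: E k w - E k.-1 w).
  have e1 : t k.+1 = t k + h by rewrite -(th k) addrC subrK.
  have e2 : t k.-1 = t k - h.
    by case: k k0 {m2 p2 v a e1} => // k _; rewrite -(th k) opprB addrC subrK.
  by rewrite /v /a e1 e2; apply/rowP => i; rewrite !mxE; ring.
have ha : enorm a <= C * h ^+ 2 by exact: second_difference_enorm.
have t1 := enormD (- a) (2 *: E k w - E k.-1 w).
have t2 := enormD (2 *: E k w) (- E k.-1 w).
rewrite !enormN enormZ ger0_norm// in t1 t2.
have := ler_wpM2l C00 (le_trans t1 (lerD ha t2)); lra.
Qed.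

(** The optimizer at time [k] is stationary for the mean gradient at time [k.+1]
    up to the drift of the mean gradient. *)
Lemma linear_gaussian_drift : bounded_drift xs (C0 * C * h / mu).
Proof.
move=> k _.
have qb j := mean_grad_quad_bounds fG (integrable_cost j).
have st j := optimizer_stationary g_ccp mu_gt0 fG (integrable_cost j).
apply: le_trans (stationary_perturbation g_ccp mu_gt0
  (quad_bounds_monotone (qb k.+1)) (st k) (st k.+1)) _.
rewrite ler_pM2r ?invr_gt0// !mean_gradient opprD addrACA subrr add0r -mulmxBl.
apply: le_trans (mulA_le _) _; rewrite -mulrA ler_wpM2l//.
have tt : t k < t k.+1 by rewrite -subr_gt0 th.
have := mean_value_enorm tt (fun s => _) dyC; rewrite th; apply.
by move=> s; rewrite derive1E; exact/derivableP.
Qed.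

Lemma linear_gaussian_tracking (alpha beta chi : R) (p c : nat)
    (x : nat -> Omega -> 'rV[R]_n) :
  0 < alpha < 2 * mu / L ^+ 2 -> 0 < beta < 2 / L -> 0 <= chi <= 1 ->
  zeta c (rho_c mu L beta) * zeta p (rho_p mu L alpha) < 1 ->
  generated alpha beta chi g f J p c y x ->
  (limn_esup (fun k => 'E_Pr[fun w => (enorm (x k w - xs k))%R]) <=
   error_bound mu L alpha beta chi p c (C0 * C * h / mu)
     ((C0 * C * h ^+ 2 + 3 * C0 * Sigma) / mu) (C0 * Sigma))%E.
Proof.
move=> ha hb hchi hzeta hx.
apply: (tracking_error_limsup n_gt0 g_ccp y_law mu_gt0 _ _ measurable_predictor
  linear_gaussian_assumption1 linear_gaussian_assumption2 linear_gaussian_drift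
  ha hb hchi hzeta hx) => //.
by move=> v z; exact: differentiable_linear_cost.
Qed.

End LinearGaussian.

(** * The tracking theorem *)

Lemma predictable_measurable (R : realType) (n d : nat) (dsp : measure_display)
    (Omega : measurableType dsp) (Pr : probability Omega R)
    (y : nat -> {RV Pr >-> borel_rV R d}) (J : nat -> Omega -> 'rV[R]_n -> 'rV[R]_n) :
  predictable y J -> forall k, (0 < k)%N -> forall x i,
  measurable_fun setT (fun w => J k.+1 w x 0 i).
Proof.
move=> pJ k k0 x i.
apply: (@measurable_coord _ _ _ _ (fun w => J k.+1 w x : borel_rV R n)) => _ B mB.
rewrite setTI; move: (pJ k k0 x B mB).
apply: smallest_sub => [|_ [j _ [B' mB' <-]]].
  exact: sigma_algebra_measurable.
exact: measurable_funPT.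
Qed.

Theorem theorem1 (R : realType) (n d : nat) (n_gt0 : (0 < n)%N)
    (dsp : measure_display) (Omega : measurableType dsp)
    (Pr : probability Omega R)
    (g : 'rV[R]_n -> \bar R) (g_ccp : closed_convex_proper g)
    (Y : nat -> probability (borel_rV R d) R)
    (y : nat -> {RV Pr >-> borel_rV R d})
    (y_law : forall k (B : set (borel_rV R d)), measurable B ->
       distribution Pr (y k) B = Y k B)
    (mu L : R) (mu_gt0 : 0 < mu) :
  (forall (f : 'rV[R]_n -> 'rV[R]_d -> R)
      (J : nat -> Omega -> 'rV[R]_n -> 'rV[R]_n) (tau sigma Delta : R),
    (forall v, twice_differentiable (f ^~ v)) ->
    (forall k, (0 < k)%N -> forall x,
       (Y k).-integrable setT (fun v => (f x v)%:E)) ->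
    predictable y J ->
    assumption1 mu L f J ->
    assumption2 Pr f Y J (optimizer f g Y) tau sigma ->
    bounded_drift (optimizer f g Y) Delta ->
    forall (alpha beta chi : R) (p c : nat) (x : nat -> Omega -> 'rV[R]_n),
      0 < alpha < 2 * mu / L ^+ 2 -> 0 < beta < 2 / L -> 0 <= chi <= 1 ->
      zeta c (rho_c mu L beta) * zeta p (rho_p mu L alpha) < 1 ->
      generated alpha beta chi g f J p c y x ->
      (limn_esup (fun k => 'E_Pr[fun w => (enorm (x k w - optimizer f g Y k))%R])
       <= error_bound mu L alpha beta chi p c Delta (tau / mu) sigma)%E)
  /\
  (forall (f' : 'rV[R]_n -> R) (A : 'M[R]_(d, n)) (C0 C h Sigma : R)
      (t : nat -> R) (ybar : R -> 'rV[R]_d)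
      (e : nat -> {RV Pr >-> borel_rV R d}) (Sg : nat -> 'M[R]_d),
    let f := linear_cost f' A in
    let J := two_point f y in
    let Delta := C0 * C * h / mu in
    let tau := C0 * C * h ^+ 2 + 3 * C0 * Sigma in
    let tau_mu := tau / mu in
    let sigma := C0 * Sigma in
    twice_differentiable f' -> strongly_convex mu f' -> smooth L f' ->
    opnorm A <= C0 ->
    0 < h -> (forall k, t k.+1 - t k = h) ->
    (forall s : R, derivable ybar s 1) ->
    (forall s : R, derivable (derive1 ybar) s 1) ->
    (forall s : R, enorm (derive1 ybar s) <= C) ->
    (forall s : R, enorm (derive1 (derive1 ybar) s) <= C) ->
    (forall k, gaussian Pr (e k) 0 (Sg k)) ->
    (forall k, Num.sqrt (\tr (Sg k)) <= Sigma) ->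
    (forall k w, y k w = (ybar (t k) + e k w : 'rV[R]_d)) ->
    [/\ assumption1 mu L f J,
        assumption2 Pr f Y J (optimizer f g Y) tau sigma,
        bounded_drift (optimizer f g Y) Delta &
        forall (alpha beta chi : R) (p c : nat) (x : nat -> Omega -> 'rV[R]_n),
          0 < alpha < 2 * mu / L ^+ 2 -> 0 < beta < 2 / L -> 0 <= chi <= 1 ->
          zeta c (rho_c mu L beta) * zeta p (rho_p mu L alpha) < 1 ->
          generated alpha beta chi g f J p c y x ->
          (limn_esup
             (fun k => 'E_Pr[fun w => (enorm (x k w - optimizer f g Y k))%R])
           <= error_bound mu L alpha beta chi p c Delta tau_mu sigma)%E]).
Proof.
split.
  move=> f J tau sigma Delta df intf pJ H1 H2 Hd alpha beta chi p c x ha hb hchi hz hx.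
  apply: (tracking_error_limsup n_gt0 g_ccp y_law mu_gt0 _ intf
    (predictable_measurable pJ) H1 H2 Hd ha hb hchi hz hx).
  by move=> v z; have [/(_ z)] := df v.
move=> f' A C0 C h Sigma t ybar e Sg f J Delta tau tau_mu sigma [df' _] cv sm AC0 h0 th
  dy ddy dyC ddyC ge trS yE; split.
- exact: linear_gaussian_assumption1.
- exact: (linear_gaussian_assumption2 y_law df' cv sm AC0 h0 th dy ddy dyC ddyC ge trS yE).
- exact: (linear_gaussian_drift g_ccp y_law mu_gt0 df' cv sm AC0 h0 th dy dyC ge yE).
- exact: (linear_gaussian_tracking n_gt0 g_ccp y_law mu_gt0 df' cv sm AC0 h0 th dy ddy dyC
    ddyC ge trS yE).
Qed.
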